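(* Let $\alpha\in\mathbb R\setminus\{0,1\}$, $\lambda\in\{1,\alpha\}$, and let $p=(p_1x_1+p_2x_2+p_3x_3+p_4x_4)x_i^{k-1}$ be a polynomial of degree $k\ge1$ in $F_{\lambda,\mathbb R}$, where $i=1$ if $\lambda=\alpha$ and $i=2$ if $\lambda=1$. Then, modulo $\mathcal I_\lambda$, for $\lambda=\alpha$ $$\pi_\alpha(C)^{-1}(p)=\tfrac{1}{2^{1+\alpha}}p_1\widetilde U_{\alpha,k}(x_1)e^{-2(x_1+x_2)}+\tfrac{1}{2^{1+\alpha}}p_2\widetilde U_{\alpha,k-1}(x_1)e^{-2(x_1-x_2)}+\tfrac{1}{2^{\alpha-1}}(p_3x_3+p_4x_4)\widetilde V_{\alpha,k-1}(x_1)e^{-2x_1},$$ and for $\lambda=1$ $$\pi_1(C)^{-1}(p)=\tfrac{1}{2^{1+\alpha^{-1}}}p_2\widetilde U_{1,k}(x_2)e^{-2(x_1+x_2)}+\tfrac{1}{2^{1+\alpha^{-1}}}p_1\widetilde U_{1,k-1}(x_2)e^{-2(x_2-x_1)}+\tfrac{1}{2^{\alpha^{-1}-1}}(p_3x_3+p_4x_4)\widetilde V_{1,k-1}(x_2)e^{-2x_2}.$$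
   Context: $x_1,x_2$ are even and $x_3,x_4$ odd coordinates, $\partial_i=\partial_{x_i}$ (left superderivatives), functions are complex valued. The relevant Bessel operators are $\mathcal B_\lambda(x_1)=(-\lambda+x_1\partial_1+x_3\partial_3+x_4\partial_4)\partial_1-2\alpha x_2\partial_3\partial_4$ and $\mathcal B_\lambda(x_2)=(-\tfrac{\lambda}{\alpha}+x_2\partial_2+x_3\partial_3+x_4\partial_4)\partial_2-2x_1\partial_3\partial_4$ (they commute). $\mathcal I_\lambda$ is the ideal generated by $2x_1x_2+x_3x_4,\ x_2^2,\ x_2x_3,\ x_2x_4$ if $\lambda=\alpha$, and by $2\alpha x_1x_2+x_3x_4,\ x_1^2,\ x_1x_3,\ x_1x_4$ if $\lambda=1$. Everything is taken modulo $\mathcal I_\lambda$ (for power series: modulo the ideal generated by $\mathcal I_\lambda$ in the ring of power series); the Bessel operators preserve this ideal. $F_{\lambda,\mathbb R}$ is the Fock space in the real coordinates $x$; in the quotient of the polynomials $\mathbb C[x_1,x_2]\otimes\Lambda(x_3,x_4)$ by $\mathcal I_\lambda$, every homogeneous element of degree $k\ge1$ can be written as $(p_1x_1+p_2x_2+p_3x_3+p_4x_4)x_i^{k-1}$ with $p_j\in\mathbb C$. The operator is $\pi_\lambda(C)^{-1}=\exp\!\big(-\tfrac12(\mathcal B_\lambda(x_1)+\mathcal B_\lambda(x_2))\big)\circ\exp(-x_1-x_2)$: first multiply by the power series $e^{-x_1-x_2}$, then apply $\sum_{j\ge0}\frac{(-1)^j}{2^jj!}(\mathcal B_\lambda(x_1)+\mathcal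 B_\lambda(x_2))^j$ to the resulting power series, the sum converging coefficientwise. Polynomials: for $k\in\mathbb N=\{0,1,2,\dots\}$ let $U(-k,b,c)=c^{k}\,{}_2F_0(-k,1-k-b;-c^{-1})=\sum_{i=0}^k\frac{(-1)^i}{i!}(-k)_i(1-k-b)_i\,c^{k-i}$ (confluent hypergeometric function of the second kind), with $(a)_i=a(a+1)\cdots(a+i-1)$. Then $\widetilde U_{\alpha,k}(x)=\sum_{i=0}^k\frac{(-1)^i}{i!}(\alpha-k+1)_i(-k)_i(4x)^{k-i}$, $\widetilde U_{1,k}(x)=\sum_{i=0}^k\frac{(-1)^i}{i!}(\alpha^{-1}-k+1)_i(-k)_i(4x)^{k-i}$, $\widetilde V_{\alpha,k}(x)=U(-k,1-\alpha,4x)$, $\widetilde V_{1,k}(x)=U(-k,1-\alpha^{-1},4x)$. *)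

(* Defs.v *)
From Stdlib Require Import Reals Factorial.
From Coquelicot Require Import Coquelicot.

Open Scope C_scope.

(** The monomials of the exterior algebra on [x3], [x4]: [1], [x3], [x4],
    [x3 x4]. *)
Inductive oddmon : Set := th1 | th3 | th4 | th34.

(** [f m a b] is the coefficient of [x1^a x2^b m]; the even variables are
    central, so their position relative to [m] is immaterial. *)
Definition sps : Type := oddmon -> nat -> nat -> C.

Definition sconst (c : C) : sps := fun m a b =>
  match m, a, b with th1, O, O => c | _, _, _ => 0 end.
Definition sadd (f g : sps) : sps := fun m a b => f m a b + g m a b.
Definition sscal (c : C) (f : sps) : sps := fun m a b => c * f m a b.
Definition sopp (f : sps) : sps := fun m a b => - f m a b.
Definition ssum (F : nat -> sps) (n : nat) : sps := fun m a b =>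
  sum_n (fun i => F i m a b) n.

Definition cauchy (u v : nat -> nat -> C) : nat -> nat -> C := fun a b =>
  sum_n (fun i => sum_n (fun j => u i j * v (a - i)%nat (b - j)%nat) b) a.

(** The sign comes from [x4 x3 = - x3 x4]. *)
Definition smul (f g : sps) : sps := fun m a b =>
  match m with
  | th1 => cauchy (f th1) (g th1) a b
  | th3 => cauchy (f th1) (g th3) a b + cauchy (f th3) (g th1) a b
  | th4 => cauchy (f th1) (g th4) a b + cauchy (f th4) (g th1) a b
  | th34 => cauchy (f th1) (g th34) a b + cauchy (f th34) (g th1) a b
            + cauchy (f th3) (g th4) a b - cauchy (f th4) (g th3) a b
  end.

Declare Scope sps_scope.
Delimit Scope sps_scope with S.
Bind Scope sps_scope with sps.
Infix "+" := sadd : sps_scope.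
Infix "*" := smul : sps_scope.
Notation "- f" := (sopp f) : sps_scope.
Notation "f - g" := (sadd f (sopp g)) : sps_scope.
Notation "c *: f" := (sscal c%C f%S)
  (at level 40, left associativity) : sps_scope.

Fixpoint spow (f : sps) (n : nat) : sps :=
  match n with O => sconst 1 | S n' => (f * spow f n')%S end.
Infix "^" := spow : sps_scope.

Definition x1 : sps := fun m a b =>
  match m, a, b with th1, 1%nat, O => 1 | _, _, _ => 0 end.
Definition x2 : sps := fun m a b =>
  match m, a, b with th1, O, 1%nat => 1 | _, _, _ => 0 end.
Definition x3 : sps := fun m a b =>
  match m, a, b with th3, O, O => 1 | _, _, _ => 0 end.
Definition x4 : sps := fun m a b =>
  match m, a, b with th4, O, O => 1 | _, _, _ => 0 end.

(** The series of [exp (s x1 + t x2)]. *)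
Definition sexp (s t : R) : sps := fun m a b =>
  match m with
  | th1 => RtoC (s ^ a / INR (fact a) * (t ^ b / INR (fact b)))
  | _ => 0
  end.

Definition is_poly (f : sps) : Prop :=
  exists N : nat, forall m a b, (N <= a + b)%nat -> f m a b = 0.

Definition d1 (f : sps) : sps := fun m a b => RtoC (INR (S a)) * f m (S a) b.
Definition d2 (f : sps) : sps := fun m a b => RtoC (INR (S b)) * f m a (S b).

(** Left superderivatives; in particular [d4 (x3 x4) = - x3]. *)
Definition d3 (f : sps) : sps := fun m a b =>
  match m with th1 => f th3 a b | th4 => f th34 a b | _ => 0 end.
Definition d4 (f : sps) : sps := fun m a b =>
  match m with th1 => f th4 a b | th3 => - f th34 a b | _ => 0 end.

Definition bessel1 (alpha lam : R) (f : sps) : sps :=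
  let g := d1 f in
  (RtoC (- lam) *: g + x1 * d1 g + x3 * d3 g + x4 * d4 g
   - RtoC (2 * alpha) *: (x2 * d3 (d4 f)))%S.

Definition bessel2 (alpha lam : R) (f : sps) : sps :=
  let g := d2 f in
  (RtoC (- (lam / alpha)) *: g + x2 * d2 g + x3 * d3 g + x4 * d4 g
   - RtoC 2 *: (x1 * d3 (d4 f)))%S.

(** The two-sided ideal generated by [G] in the subring [A]. *)
Inductive ideal_gen (A G : sps -> Prop) : sps -> Prop :=
| ideal_in f : G f -> ideal_gen A G f
| ideal_zero : ideal_gen A G (sconst 0)
| ideal_add f g : ideal_gen A G f -> ideal_gen A G g -> ideal_gen A G (f + g)%S
| ideal_mul_l h f : A h -> ideal_gen A G f -> ideal_gen A G (h * f)%S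
| ideal_mul_r h f : A h -> ideal_gen A G f -> ideal_gen A G (f * h)%S.

Definition Igens (alpha lam : R) (g : sps) : Prop :=
  (lam = alpha /\
   (g = RtoC 2 *: (x1 * x2) + x3 * x4 \/ g = x2 ^ 2 \/ g = x2 * x3
    \/ g = x2 * x4)%S) \/
  (lam = 1%R /\
   (g = RtoC (2 * alpha) *: (x1 * x2) + x3 * x4 \/ g = x1 ^ 2 \/ g = x1 * x3
    \/ g = x1 * x4)%S).

(** Congruence modulo [I_lambda] in the polynomials, that is, equality in the
    Fock space, and modulo the ideal generated by [I_lambda] in the ring of
    power series. *)
Definition eq_fock (alpha lam : R) (f g : sps) : Prop :=
  ideal_gen is_poly (Igens alpha lam) (f - g)%S.
Definition eq_series (alpha lam : R) (f g : sps) : Prop :=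
  ideal_gen (fun _ => True) (ideal_gen is_poly (Igens alpha lam)) (f - g)%S.

Definition piCinv_term (alpha lam : R) (f : sps) (j : nat) : sps :=
  (RtoC ((-1) ^ j / (2 ^ j * INR (fact j))) *:
   Nat.iter j (fun g => bessel1 alpha lam g + bessel2 alpha lam g)
     (sexp (-1) (-1) * f))%S.

(** [F] is the coefficientwise sum of the series defining the image of [f]. *)
Definition is_piCinv (alpha lam : R) (f F : sps) : Prop :=
  forall m a b,
    is_series (V := C_NormedModule)
      (fun j => piCinv_term alpha lam f j m a b) (F m a b).

Fixpoint poch (a : R) (i : nat) : R :=
  match i with O => 1%R | S i' => (poch a i' * (a + INR i'))%R end.

(** [U(-k, b, c) = c^k 2F0(-k, 1-k-b; -1/c)], with the terminating sum expanded,
    which makes sense for any series [c]. *)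
Definition hypU (k : nat) (b : R) (c : sps) : sps :=
  ssum (fun i =>
    RtoC ((-1) ^ i / INR (fact i) * poch (- INR k) i * poch (1 - INR k - b) i)
      *: c ^ (k - i))%S k.

(** [a = alpha] gives the polynomials of index [lambda = alpha], and
    [a = 1 / alpha] those of index [lambda = 1]. *)
Definition Utilde (a : R) (k : nat) (x : sps) : sps :=
  ssum (fun i =>
    RtoC ((-1) ^ i / INR (fact i) * poch (a - INR k + 1) i * poch (- INR k) i)
      *: (RtoC 4 *: x) ^ (k - i))%S k.
Definition Vtilde (a : R) (k : nat) (x : sps) : sps :=
  hypU k (1 - a) (RtoC 4 *: x)%S.

(* Main.v *)
Require Import Defs.
From Stdlib Require Import Reals Factorial Lra Lia.
From Stdlib Require Import FunctionalExtensionality ClassicalEpsilon.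
From Coquelicot Require Import Coquelicot.

(** Let [lambda = alpha].  Modulo the ideal, [x3 x4 = -2 x1 x2] and
    [x2^2 = x2 x3 = x2 x4 = 0], so every power series reduces to
    [u1(x1) + u2(x1) x2 + u3(x1) x3 + u4(x1) x4] for four series in one variable.
    On these the sum [T] of the two Bessel operators acts as
    [(u1, u2, u3, u4) |-> (D u1 - u2, D u2, D' u3, D' u4)], where
    [D = x d^2 - a d] with [a = alpha], and [D'] is [D] with [a - 1] for [a]
    ([has_red_besselT]).  Hence [exp(-T/2)] sends [(u1, u2, u3, u4)] to
    [(E u1 + E u2 / 2, E u2, E' u3, E' u4)] with [E = exp(-D/2)], and
    multiplication by [exp(-x1-x2)] is
    [(u1, u2, u3, u4) |-> exp(-x) (u1, u2 - u1, u3, u4)].  Everything is thus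
    reduced to the one-variable identity
    [E (x^k exp(-x)) = 2^(-a) U_k(x) exp(-2x)] ([is_exp_besselD_monomial]).

    For [k = 0] the coefficients of [E (exp(-x))] are binomial series at [1/2],
    whence the power of [2] ([binomial_series_half]).  The step from [k] to
    [k + 1] uses [[D, x] = H] with [H = 2 x d - a], and [[D, H] = 2 D]: they give
    [E x = (x - H/2 + D/4) E] ([is_exp_besselD_mulx]), and conjugating
    [x - H/2 + D/4] by [exp(-2x)] gives the recursion in [k] of the
    polynomials [U_k] ([twisted_conj_Useq]).

    The sum defining [exp(-T/2)] has to converge before reduction, for every
    polynomial representing the class.  If the coefficients of
    [x1^m x2^n] in [f] are [O(r^(m+n) / (m! n!))], then, for fixed [m] and
    [n], those of [T^j f] are [O((s r)^j j^c j!)] as [j] grows, for any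
    [s > 1] and some exponent [c] ([iter_besselT_bound]).  Any [r > 1] is
    possible for [exp(-x1-x2) p], and [s r < 2] gives convergence after
    division by [2^j j!].

    The case [lambda = 1] is the same computation after exchanging [x1] and
    [x2].  It has [a = 1 / alpha] and the relation [x3 x4 = -2 alpha x1 x2];
    a parameter [mu] in the relation [x3 x4 = -2 mu x1 x2] covers both
    cases. *)

Local Notation cauchy := Defs.cauchy.
Local Notation d1 := Defs.d1.
Local Notation d2 := Defs.d2.

Local Open Scope R_scope.

(** * Binomial series *)

Lemma fact_pos (n : nat) : 0 < INR (fact n).
Proof. apply lt_0_INR, lt_O_fact. Qed.

Lemma fact_S (n : nat) : INR (fact (S n)) = (INR n + 1) * INR (fact n).
Proof. rewrite <- S_INR, <- mult_INR. reflexivity. Qed.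

Lemma poch_S_l (a : R) (j : nat) : poch a (S j) = a * poch (a + 1) j.
Proof.
  induction j as [|j IH]; [simpl; ring|].
  change (poch a (S (S j))) with (poch a (S j) * (a + INR (S j))).
  rewrite IH, S_INR. simpl. ring.
Qed.

Lemma poch_pos (a : R) (j : nat) : 0 < a -> 0 < poch a j.
Proof.
  intros Ha; induction j as [|j IH]; simpl; [lra|].
  apply Rmult_lt_0_compat; [exact IH|]. pose proof (pos_INR j). lra.
Qed.

Lemma Rabs_poch_le (a b : R) (j : nat) :
  Rabs a <= b -> Rabs (poch a j) <= poch b j.
Proof.
  intros Hab; induction j as [|j IH]; simpl.
  - rewrite Rabs_R1; lra.
  - rewrite Rabs_mult. apply Rmult_le_compat; try apply Rabs_pos; [exact IH|].
    eapply Rle_trans; [apply Rabs_triang|].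
    rewrite (Rabs_pos_eq (INR j)) by apply pos_INR. lra.
Qed.

Definition bincoef (b : R) (j : nat) : R := poch b j / INR (fact j).

Lemma bincoef_S (b : R) (j : nat) :
  (INR j + 1) * bincoef b (S j) = (b + INR j) * bincoef b j.
Proof.
  unfold bincoef. rewrite fact_S. simpl. pose proof (pos_INR j).
  pose proof (fact_pos j). field. lra.
Qed.

(** D'Alembert's criterion needs nonzero terms, which fails when [b] is a
    nonpositive integer; comparison with [Rabs b + 1] avoids this. *)
Lemma bincoef_disk (b x : R) : Rabs x < 1 -> CV_disk (bincoef b) x.
Proof.
  intros Hx. set (B := Rabs b + 1).
  assert (HB : 0 < B) by (unfold B; pose proof (Rabs_pos b); lra).
  assert (Hpos : forall n, 0 < bincoef B n).
  { intros n. apply Rdiv_lt_0_compat; [apply poch_pos, HB | apply fact_pos]. }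
  assert (HD : CV_disk (bincoef B) x).
  { apply CV_disk_DAlembert with (l := 1).
    - intros n. specialize (Hpos n). lra.
    - apply is_lim_seq_ext with (fun n => 1 + (B - 1) * / INR (S n)).
      + intros n. pose proof (Hpos n). pose proof (Hpos (S n)).
        pose proof (pos_INR n) as Hn.
        rewrite Rabs_pos_eq by (apply Rlt_le, Rdiv_lt_0_compat; assumption).
        rewrite S_INR.
        replace (bincoef B (S n))
          with ((B + INR n) * bincoef B n / (INR n + 1)).
        * field. lra.
        * rewrite <- bincoef_S. field. lra.
      + replace (Finite 1) with (Finite (1 + (B - 1) * 0)) by (f_equal; ring).
        apply is_lim_seq_plus'; [apply is_lim_seq_const|].
        apply (is_lim_seq_scal_l (fun n => / INR (S n)) (B - 1) (Finite 0)).
        apply (is_lim_seq_incr_1 (fun n => / INR n)).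
        apply (is_lim_seq_inv INR p_infty); [apply is_lim_seq_INR | discriminate].
    - right. split; [lra|]. rewrite Rinv_1. exact Hx. }
  apply (ex_series_le (K := R_AbsRing) (V := R_CompleteNormedModule) _
           (fun n => Rabs (bincoef B n * x ^ n))); [|exact HD].
  intros n. change (norm (Rabs (bincoef b n * x ^ n)))
    with (Rabs (Rabs (bincoef b n * x ^ n))).
  rewrite Rabs_Rabsolu, !Rabs_mult.
  apply Rmult_le_compat_r; [apply Rabs_pos|].
  rewrite (Rabs_pos_eq (bincoef B n)) by apply Rlt_le, Hpos.
  unfold bincoef, Rdiv. rewrite Rabs_mult.
  rewrite (Rabs_pos_eq (/ _)) by (apply Rlt_le, Rinv_0_lt_compat, fact_pos).
  apply Rmult_le_compat_r;
    [apply Rlt_le, Rinv_0_lt_compat, fact_pos|].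
  apply Rabs_poch_le. unfold B; lra.
Qed.

Lemma bincoef_radius (b x : R) :
  Rabs x < 1 -> Rbar_lt (Rabs x) (CV_radius (bincoef b)).
Proof.
  intros Hx. set (r := (1 + Rabs x) / 2).
  pose proof (Rabs_pos x) as Hx0.
  apply Rbar_lt_le_trans with (Finite r); [unfold r; simpl; lra|].
  apply (proj1 (CV_radius_bounded (bincoef b))).
  assert (Hr : Rabs r < 1) by (rewrite Rabs_pos_eq; unfold r; lra).
  pose proof (bincoef_disk b r Hr) as Hd.
  apply ex_series_lim_0, is_lim_seq_spec in Hd.
  destruct (Hd (mkposreal 1 Rlt_0_1)) as [N HN]. simpl in HN.
  (* the terms tend to 0, so all but finitely many are below 1 *)
  assert (Hfin : forall N, exists M,
             forall n, (n < N)%nat -> Rabs (bincoef b n * r ^ n) <= M).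
  { clear. intros N; induction N as [|N [M HM]].
    - exists 0. intros; lia.
    - exists (Rmax M (Rabs (bincoef b N * r ^ N))). intros n Hn.
      destruct (Nat.eq_dec n N) as [->|Hne]; [apply Rmax_r|].
      eapply Rle_trans; [apply HM; lia | apply Rmax_l]. }
  destruct (Hfin N) as [M HM]. exists (Rmax M 1). intros n.
  destruct (Compare_dec.le_lt_dec N n) as [Hn|Hn].
  - specialize (HN n Hn). rewrite Rminus_0_r, Rabs_Rabsolu in HN.
    eapply Rle_trans; [apply Rlt_le, HN | apply Rmax_r].
  - eapply Rle_trans; [apply HM, Hn | apply Rmax_l].
Qed.

(** The sum [f] of the binomial series satisfies [(1 - x) f' = b f], so
    [f (1 - x)^b] is constant on [[0, 1/2]]. *)
Lemma binomial_series_half (b : R) :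
  is_series (fun j => bincoef b j * (1 / 2) ^ j) (Rpower 2 b).
Proof.
  assert (Hr : forall x, 0 <= x <= 1 / 2 -> Rbar_lt (Rabs x) (CV_radius (bincoef b))).
  { intros x Hx. apply bincoef_radius. rewrite Rabs_pos_eq; lra. }
  set (f := PSeries (bincoef b)).
  assert (Hode : forall x, 0 <= x <= 1 / 2 ->
            (1 - x) * PSeries (PS_derive (bincoef b)) x = b * f x).
  { intros x Hx. specialize (Hr x Hx).
    assert (Hex : ex_pseries (PS_derive (bincoef b)) x).
    { apply CV_radius_inside. rewrite CV_radius_derive. exact Hr. }
    assert (Heq : PSeries (PS_derive (bincoef b)) x
       = PSeries (PS_plus (PS_scal b (bincoef b))
                          (PS_incr_1 (PS_derive (bincoef b)))) x).
    { apply PSeries_ext. intros n. unfold PS_derive, PS_plus, PS_scal.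
      rewrite S_INR, bincoef_S. unfold PS_incr_1.
      destruct n as [|n]; unfold plus, scal, zero, mult; simpl;
        unfold mult; simpl; [ring|].
      change (match n with O => 1 | S _ => INR n + 1 end) with (INR (S n)).
      ring. }
    rewrite PSeries_plus in Heq.
    - rewrite PSeries_scal, PSeries_incr_1 in Heq. fold f in Heq.
      lra.
    - apply ex_pseries_scal; [apply Rmult_comm|]. apply CV_radius_inside, Hr.
    - apply ex_pseries_incr_1, Hex. }
  assert (Hg : f 0 * exp (b * ln (1 - 0)) = f (1 / 2) * exp (b * ln (1 - 1 / 2))).
  { apply (eq_is_derive (fun x => f x * exp (b * ln (1 - x)))); [|lra].
    intros x Hx.
    evar_last.
    - apply (is_derive_mult f (fun x => exp (b * ln (1 - x)))).
      + apply is_derive_PSeries, Hr, Hx.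
      + auto_derive; [lra|reflexivity].
      + intros; apply Rmult_comm.
    - unfold zero, plus, mult; simpl.
      replace (PSeries (PS_derive (bincoef b)) x) with (b * f x / (1 - x)).
      + change (1 + - x) with (1 - x). field. lra.
      + rewrite <- Hode by exact Hx. field. lra. }
  assert (Hf : f (1 / 2) = Rpower 2 b).
  { unfold f in Hg at 1. rewrite PSeries_0 in Hg.
    unfold bincoef in Hg at 1. simpl in Hg.
    rewrite Rminus_0_r, ln_1, Rmult_0_r, exp_0 in Hg.
    replace (1 - 1 / 2) with (/ 2) in Hg by field.
    rewrite ln_Rinv in Hg by lra. unfold Rpower.
    replace (b * - ln 2) with (- (b * ln 2)) in Hg by ring.
    rewrite exp_Ropp in Hg. pose proof (exp_pos (b * ln 2)).
    replace (f (1 / 2)) with (f (1 / 2) * / exp (b * ln 2) * exp (b * ln 2))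
      by (field; lra).
    rewrite <- Hg. field. }
  rewrite <- Hf. unfold f.
  assert (Hex : ex_pseries (bincoef b) (1 / 2)) by (apply CV_radius_inside, Hr; lra).
  apply PSeries_correct in Hex. unfold is_pseries in Hex.
  eapply is_series_ext; [|exact Hex]. intros n. simpl.
  rewrite pow_n_pow. unfold scal; simpl; unfold mult; simpl. ring.
Qed.

Local Open Scope C_scope.

(** * Complex series and finite sums *)

(** Compares real and imaginary parts, which turns identities with embedded
    real coefficients into identities in the field [R]. *)
Ltac by_parts :=
  apply injective_projections; cbn [fst snd Cmult Cplus Copp Cminus RtoC].

(** Summation lemmas leave equations typed in the carrier of an algebraic
    structure, where [ring] does not recognise [C] or [R]. *)
Ltac cring :=
  first [ring
        | match goal with |- @eq _ ?a ?b => change (@eq C a b) end; ring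
        | match goal with |- @eq _ ?a ?b => change (@eq R a b) end; ring].

(** Fixes the normed module structure on [C], so that series of complex
    numbers need no annotation. *)
Definition is_Cseries (u : nat -> C) (l : C) : Prop :=
  is_series (V := C_NormedModule) u l.

Lemma is_Cseries_plus (u v : nat -> C) (l m : C) :
  is_Cseries u l -> is_Cseries v m -> is_Cseries (fun j => u j + v j) (l + m).
Proof. exact (is_series_plus (K := C_AbsRing) (V := C_NormedModule) u v l m). Qed.

Lemma is_Cseries_scal (c : C) (u : nat -> C) (l : C) :
  is_Cseries u l -> is_Cseries (fun j => c * u j) (c * l).
Proof. exact (is_series_scal (K := C_AbsRing) (V := C_NormedModule) c u l). Qed.

Lemma is_Cseries_ext (u v : nat -> C) (l m : C) :
  is_Cseries u l -> (forall j, u j = v j) -> l = m -> is_Cseries v m.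
Proof. intros Hu Huv <-. exact (is_series_ext (V := C_NormedModule) u v l Huv Hu). Qed.

Lemma is_Cseries_0 : is_Cseries (fun _ => 0) 0.
Proof.
  apply filterlim_ext with (fun _ => RtoC 0).
  - intros n. symmetry. induction n as [|n IH].
    + apply sum_O.
    + rewrite sum_Sn, IH. apply Cplus_0_l.
  - apply filterlim_const.
Qed.

Lemma is_Cseries_unique (u : nat -> C) (l m : C) :
  is_Cseries u l -> is_Cseries u m -> l = m.
Proof. apply (filterlim_locally_unique (V := C_NormedModule)). Qed.

Lemma is_Cseries_RtoC (u : nat -> R) (l : R) :
  is_series u l -> is_Cseries (fun j => RtoC (u j)) (RtoC l).
Proof.
  intros Hu. unfold is_series in *.
  apply filterlim_ext with (fun n => RtoC (sum_n u n)).
  { intros n; induction n as [|n IH].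
    - rewrite !sum_O. reflexivity.
    - rewrite !sum_Sn, <- IH. apply RtoC_plus. }
  apply (filterlim_locally (F := eventually) (U := C_NormedModule)). intros eps.
  pose proof (proj1 (filterlim_locally (F := eventually) _ _) Hu eps) as [N HN].
  exists N. intros n Hn. split; [exact (HN n Hn)|].
  change (ball (0%R : R_UniformSpace) eps 0%R). apply ball_center.
Qed.

Lemma csum_S (u : nat -> C) (n : nat) :
  sum_n u (S n) = sum_n u n + u (S n).
Proof. exact (sum_Sn (G := C_AbelianMonoid) u n). Qed.

Lemma csum_S_l (u : nat -> C) (n : nat) :
  sum_n u (S n) = u O + sum_n (fun i => u (S i)) n.
Proof.
  induction n as [|n IH].
  - rewrite csum_S, !sum_O. reflexivity.
  - rewrite csum_S, IH, csum_S. cring.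
Qed.

Lemma csum_plus (u v : nat -> C) (n : nat) :
  sum_n (fun i => u i + v i) n = sum_n u n + sum_n v n.
Proof. apply (sum_n_plus (G := C_AbelianMonoid)). Qed.

Lemma csum_mult_l (c : C) (u : nat -> C) (n : nat) :
  sum_n (fun i => c * u i) n = c * sum_n u n.
Proof. apply (sum_n_mult_l (K := C_Ring)). Qed.

Lemma csum_0 (u : nat -> C) (n : nat) :
  (forall i, (i <= n)%nat -> u i = 0) -> sum_n u n = RtoC 0.
Proof.
  intros Hu; induction n as [|n IH].
  - rewrite sum_O. apply Hu; lia.
  - rewrite csum_S, IH, Hu by (intros; try apply Hu; lia). cring.
Qed.

(** * Formal power series in one variable *)

(** Multiplication by the variable; also serves to shift the summation index
    of a series by one. *)
Definition mulx (u : nat -> C) : nat -> C := fun n =>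
  match n with O => 0 | S n' => u n' end.
Definition deriv (u : nat -> C) : nat -> C := fun n => RtoC (INR n + 1) * u (S n).
Definition conv (u v : nat -> C) : nat -> C := fun n =>
  sum_n (fun i => u i * v (n - i)%nat) n.
Definition delta (k : nat) : nat -> C := fun n => if Nat.eqb n k then 1 else 0.
Definition expseq (s : R) : nat -> C := fun n => RtoC (s ^ n / INR (fact n)).

Lemma is_Cseries_mulx (u : nat -> C) (l : C) :
  is_Cseries u l -> is_Cseries (mulx u) l.
Proof.
  intros Hu. apply (is_series_decr_1 (V := C_NormedModule) (mulx u)). simpl.
  eapply is_Cseries_ext; [exact Hu | reflexivity |].
  change (l = l + - RtoC 0). cring.
Qed.

Lemma conv_ext (u u' v v' : nat -> C) (n : nat) :
  (forall i, (i <= n)%nat -> u i = u' i) ->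
  (forall i, (i <= n)%nat -> v i = v' i) -> conv u v n = conv u' v' n.
Proof.
  intros Hu Hv. apply sum_n_ext_loc. intros i Hi.
  rewrite Hu, Hv by lia. reflexivity.
Qed.

Lemma conv_0_l (v : nat -> C) (n : nat) : conv (fun _ => 0) v n = 0.
Proof. apply csum_0. intros. cring. Qed.

Lemma conv_0_r (u : nat -> C) (n : nat) : conv u (fun _ => 0) n = 0.
Proof. apply csum_0. intros. cring. Qed.

Lemma conv_lin_l (c d : C) (u w v : nat -> C) (n : nat) :
  conv (fun i => c * u i + d * w i) v n = c * conv u v n + d * conv w v n.
Proof.
  unfold conv. rewrite <- !csum_mult_l, <- csum_plus.
  apply sum_n_ext. intros i. cring.
Qed.

Lemma conv_lin_r (c d : C) (u v w : nat -> C) (n : nat) :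
  conv u (fun i => c * v i + d * w i) n = c * conv u v n + d * conv u w n.
Proof.
  unfold conv. rewrite <- !csum_mult_l, <- csum_plus.
  apply sum_n_ext. intros i. cring.
Qed.

Lemma conv_mulx_l (u v : nat -> C) (n : nat) : conv (mulx u) v n = mulx (conv u v) n.
Proof.
  unfold conv. destruct n as [|n].
  - rewrite sum_O. simpl. cring.
  - rewrite csum_S_l. simpl. cring.
Qed.

Lemma conv_mulx_r (u v : nat -> C) (n : nat) : conv u (mulx v) n = mulx (conv u v) n.
Proof.
  unfold conv. destruct n as [|n].
  - rewrite sum_O. simpl. cring.
  - rewrite csum_S, Nat.sub_diag. simpl mulx at 2. rewrite Cmult_0_r, Cplus_0_r.
    apply sum_n_ext_loc. intros i Hi.
    rewrite Nat.sub_succ_l by exact Hi. reflexivity.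
Qed.

(** Leibniz rule: [n u_i v_(n-i) = i u_i v_(n-i) + u_i (n-i) v_(n-i)]. *)
Lemma deriv_conv (u v : nat -> C) (n : nat) :
  deriv (conv u v) n = conv (deriv u) v n + conv u (deriv v) n.
Proof.
  unfold deriv at 1. unfold conv at 1. rewrite <- csum_mult_l.
  transitivity
    (sum_n (fun i => RtoC (INR i) * u i * v (S n - i)%nat
                     + u i * (RtoC (INR (S n - i)) * v (S n - i)%nat)) (S n)).
  { apply sum_n_ext_loc. intros i Hi. rewrite minus_INR, S_INR by exact Hi.
    by_parts; cring. }
  rewrite csum_plus. f_equal.
  - rewrite csum_S_l. simpl INR at 1. rewrite !Cmult_0_l, Cplus_0_l.
    apply sum_n_ext. intros i. unfold deriv. rewrite S_INR. reflexivity.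
  - rewrite csum_S, Nat.sub_diag. simpl INR at 2.
    rewrite Cmult_0_l, Cmult_0_r, Cplus_0_r.
    apply sum_n_ext_loc. intros i Hi. rewrite Nat.sub_succ_l by exact Hi.
    unfold deriv. rewrite S_INR. reflexivity.
Qed.

Lemma conv_delta (k : nat) (v : nat -> C) :
  conv (delta k) v = Nat.iter k mulx v.
Proof.
  induction k as [|k IH]; apply functional_extensionality; intros n.
  - unfold conv. destruct n as [|n].
    + rewrite sum_O. simpl. unfold delta. simpl. cring.
    + rewrite csum_S_l, csum_0.
      * unfold delta. simpl. cring.
      * intros i _. unfold delta. simpl. cring.
  - simpl. rewrite <- IH, <- conv_mulx_l.
    apply conv_ext; [|reflexivity]. intros [|i] _; reflexivity.
Qed.

Lemma deriv_expseq (s : R) (n : nat) : deriv (expseq s) n = RtoC s * expseq s n.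
Proof.
  unfold deriv, expseq. rewrite <- !RtoC_mult. f_equal. rewrite fact_S. simpl pow.
  pose proof (pos_INR n). pose proof (fact_pos n). field. lra.
Qed.

(** * The one-variable exponential *)

(** The operator [D = x d^2 - a d] on coefficient sequences. *)
Definition besselD (a : R) (u : nat -> C) : nat -> C := fun n =>
  RtoC ((INR n + 1) * (INR n - a)) * u (S n).

(** The coefficient of [t^j] in [exp(-t/2)]. *)
Definition exp_half (j : nat) : R := ((-1) ^ j / (2 ^ j * INR (fact j)))%R.

(** [h = exp(-D/2) g], coefficient by coefficient. *)
Definition is_exp_besselD (a : R) (g h : nat -> C) : Prop := forall n,
  is_Cseries (fun j => RtoC (exp_half j) * Nat.iter j (besselD a) g n) (h n).

Lemma exp_half_S (j : nat) : (exp_half (S j) * (INR j + 1) = - (1 / 2) * exp_half j)%R.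
Proof.
  unfold exp_half. rewrite fact_S. simpl pow.
  pose proof (pos_INR j). pose proof (fact_pos j).
  pose proof (pow_lt 2 j Rlt_0_2). field. lra.
Qed.

Lemma iter_besselD_lin (a : R) (c d : C) (u v : nat -> C) (j n : nat) :
  Nat.iter j (besselD a) (fun i => c * u i + d * v i) n
  = c * Nat.iter j (besselD a) u n + d * Nat.iter j (besselD a) v n.
Proof.
  revert n; induction j as [|j IH]; intros n; [reflexivity|].
  simpl. unfold besselD at 1 3 5. rewrite IH. cring.
Qed.

Lemma is_exp_besselD_lin (a : R) (c d : C) (u v hu hv : nat -> C) :
  is_exp_besselD a u hu -> is_exp_besselD a v hv ->
  is_exp_besselD a (fun i => c * u i + d * v i) (fun i => c * hu i + d * hv i).
Proof.
  intros Hu Hv n.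
  eapply is_Cseries_ext;
    [exact (is_Cseries_plus _ _ _ _ (is_Cseries_scal c _ _ (Hu n))
                                    (is_Cseries_scal d _ _ (Hv n))) | |reflexivity].
  intros j. cbv beta. rewrite iter_besselD_lin. cring.
Qed.

(** [D^(i+1) x = x D^(i+1) + (i+1) H D^i + (i+1) i D^i] with
    [H = 2 x d - a], by induction from [D x = x D + H] and
    [D H = H D + 2 D]. *)
Lemma iter_besselD_mulx (a : R) (g : nat -> C) (i n : nat) :
  Nat.iter (S i) (besselD a) (mulx g) n
  = mulx (Nat.iter (S i) (besselD a) g) n
    + RtoC ((INR i + 1) * (2 * INR n - a + INR i)) * Nat.iter i (besselD a) g n.
Proof.
  revert n; induction i as [|i IH]; intros n.
  - destruct n as [|n]; simpl Nat.iter; unfold besselD, mulx; rewrite ?S_INR;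
      simpl INR; by_parts; cring.
  - change (Nat.iter (S (S i)) (besselD a) (mulx g) n)
      with (besselD a (Nat.iter (S i) (besselD a) (mulx g)) n).
    unfold besselD at 1. rewrite IH.
    change (mulx (Nat.iter (S i) (besselD a) g) (S n))
      with (Nat.iter (S i) (besselD a) g n).
    change (Nat.iter (S (S i)) (besselD a) g)
      with (besselD a (Nat.iter (S i) (besselD a) g)).
    change (Nat.iter (S i) (besselD a) g) with (besselD a (Nat.iter i (besselD a) g)).
    destruct n as [|n]; unfold mulx, besselD; rewrite ?S_INR; simpl INR; by_parts; cring.
Qed.

(** The operator [x - H/2 + D/4], that is, [x] conjugated by
    [exp(-D/2)]. *)
Definition besselD_conj (a : R) (h : nat -> C) : nat -> C := fun n =>
  mulx h n + RtoC (a / 2 - INR n) * h n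
  + RtoC ((INR n + 1) * (INR n - a) / 4) * h (S n).

(** In the commutation formula for [D^j x], the terms [j H D^(j-1)] and
    [j (j-1) D^(j-1)] absorb one and two factors of [j!]: after a shift of
    the summation index by one and by two they sum to [-H/2] and
    [D/4] applied to [exp(-D/2) g]. *)
Lemma is_exp_besselD_mulx (a : R) (g h : nat -> C) :
  is_exp_besselD a g h -> is_exp_besselD a (mulx g) (besselD_conj a h).
Proof.
  intros Hg n. unfold besselD_conj.
  eapply is_Cseries_ext.
  - apply is_Cseries_plus; [apply is_Cseries_plus|].
    + instantiate (1 := mulx h n).
      instantiate (1 := fun j => RtoC (exp_half j) * mulx (Nat.iter j (besselD a) g) n).
      destruct n as [|n]; [|apply Hg].
      eapply is_Cseries_ext; [apply is_Cseries_0| |reflexivity].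
      intros j. simpl. cring.
    + exact (is_Cseries_mulx _ _
        (is_Cseries_scal (RtoC (a / 2 - INR n)) _ _ (Hg n))).
    + exact (is_Cseries_mulx _ _ (is_Cseries_mulx _ _
        (is_Cseries_scal (RtoC ((INR n + 1) * (INR n - a) / 4)) _ _ (Hg (S n))))).
  - intros [|j]; [simpl; cring|]. cbv beta. rewrite iter_besselD_mulx.
    pose proof (exp_half_S j) as Hj.
    assert (Hj' : (exp_half (S j) = - (1 / 2) * exp_half j / (INR j + 1))%R).
    { rewrite <- Hj. pose proof (pos_INR j). field. lra. }
    destruct j as [|j].
    + simpl mulx. rewrite Hj'. simpl Nat.iter. simpl INR. by_parts; field.
    + generalize (mulx (Nat.iter (S (S j)) (besselD a) g) n). intros z.
      assert (HD : Nat.iter (S j) (besselD a) g n = RtoC ((INR n + 1) * (INR n - a))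
                   * Nat.iter j (besselD a) g (S n)) by reflexivity.
      cbn [mulx]. rewrite HD, Hj'.
      replace (exp_half (S j)) with (- (1 / 2) * exp_half j / (INR j + 1))%R
        by (rewrite <- exp_half_S; pose proof (pos_INR j); field; lra).
      rewrite !S_INR. pose proof (pos_INR j). by_parts; field; lra.
  - reflexivity.
Qed.

Lemma iter_besselD_expseq (a : R) (j n : nat) :
  Nat.iter j (besselD a) (expseq (-1)) n
  = RtoC (poch (INR n - a) j * (-1) ^ j) * expseq (-1) n.
Proof.
  revert n; induction j as [|j IH]; intros n.
  - simpl. unfold expseq. by_parts; cring.
  - simpl Nat.iter. unfold besselD at 1. rewrite IH, poch_S_l. unfold expseq.
    rewrite <- !RtoC_mult. f_equal. rewrite fact_S, S_INR. simpl pow.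
    replace (INR n + 1 - a)%R with (INR n - a + 1)%R by cring.
    pose proof (pos_INR n). pose proof (fact_pos n). field. lra.
Qed.

(** [D^j] multiplies the coefficient of [x^n] in [exp(-x)] by
    [(-1)^j (n-a)_j], so the series is the binomial series of exponent
    [n - a] at [1/2]. *)
Lemma is_exp_besselD_expseq (a : R) :
  is_exp_besselD a (expseq (-1)) (fun n => RtoC (Rpower 2 (- a)) * expseq (-2) n).
Proof.
  intros n.
  eapply is_Cseries_ext.
  - apply (is_Cseries_scal (expseq (-1) n)), is_Cseries_RtoC.
    apply (binomial_series_half (INR n - a)).
  - intros j. cbv beta. rewrite iter_besselD_expseq.
    replace (bincoef (INR n - a) j * (1 / 2) ^ j)%R
      with (exp_half j * (poch (INR n - a) j * (-1) ^ j))%R.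
    + rewrite (RtoC_mult (exp_half j)). cring.
    + unfold exp_half, bincoef, Rdiv. rewrite Rpow_mult_distr, pow1, pow_inv, Rinv_mult.
      replace ((-1) ^ j * (/ 2 ^ j * / INR (fact j)) *
        (poch (INR n - a) j * (-1) ^ j))%R
        with (((-1) ^ j * (-1) ^ j) * (poch (INR n - a) j * / INR (fact j)
               * (1 * / 2 ^ j)))%R by cring.
      rewrite <- Rpow_mult_distr. replace (-1 * -1)%R with 1%R by cring.
      rewrite pow1. cring.
  - unfold expseq. rewrite <- !RtoC_mult. f_equal.
    unfold Rminus. rewrite Rpower_plus, Rpower_pow by lra.
    replace (-2)%R with (-1 * 2)%R by cring. rewrite Rpow_mult_distr.
    unfold Rdiv. cring.
Qed.

(** The operator [x - H/2 + D/4] with [d] replaced by [d - 2]. *)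
Definition twisted_conj (a : R) (u : nat -> C) : nat -> C := fun n =>
  RtoC 4 * mulx u n + RtoC (a - 2 * INR n) * u n
  + RtoC ((INR n + 1) * (INR n - a) / 4) * u (S n).

Lemma deriv_conv_expseq (s : R) (u : nat -> C) (n : nat) :
  deriv (conv u (expseq s)) n = conv (fun i => 1 * deriv u i + RtoC s * u i) (expseq s) n.
Proof.
  rewrite deriv_conv, conv_lin_l.
  rewrite (conv_ext u u (deriv (expseq s))
             (fun i => RtoC s * expseq s i + 0 * expseq s i));
    [|reflexivity|intros; rewrite deriv_expseq; cring].
  rewrite conv_lin_r. cring.
Qed.

Lemma mulx_deriv (u : nat -> C) (n : nat) : RtoC (INR n) * u n = mulx (deriv u) n.
Proof. destruct n as [|n]; unfold mulx, deriv; [simpl; cring|now rewrite S_INR]. Qed.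

(** On [u exp(-2x)] the derivation acts as [d - 2] on [u]. *)
Lemma besselD_conj_conv (a : R) (u : nat -> C) :
  besselD_conj a (conv u (expseq (-2))) = conv (twisted_conj a u) (expseq (-2)).
Proof.
  set (u1 := fun i => 1 * deriv u i + RtoC (-2) * u i).
  set (u2 := fun i => 1 * deriv u1 i + RtoC (-2) * u1 i).
  assert (H1 : deriv (conv u (expseq (-2))) = conv u1 (expseq (-2)))
    by (apply functional_extensionality; intros; apply deriv_conv_expseq).
  assert (H2 : deriv (conv u1 (expseq (-2))) = conv u2 (expseq (-2)))
    by (apply functional_extensionality; intros; apply deriv_conv_expseq).
  apply functional_extensionality; intros n. unfold besselD_conj.
  transitivity (mulx (conv u (expseq (-2))) n + RtoC (a / 2) * conv u (expseq (-2)) n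
    - RtoC (INR n) * conv u (expseq (-2)) n
    + RtoC (1 / 4) * (RtoC (INR n) * deriv (conv u (expseq (-2))) n)
    - RtoC (a / 4) * deriv (conv u (expseq (-2))) n).
  { unfold deriv. by_parts; field. }
  rewrite (mulx_deriv (conv u _)), H1, (mulx_deriv (conv u1 _)), H2.
  rewrite <- !conv_mulx_l.
  transitivity (conv (fun i => 1 * (fun i => 1 * mulx u i + RtoC (a / 2) * u i) i
    + 1 * (fun i => RtoC (-1) * mulx u1 i + 1 *
           (fun i => RtoC (1 / 4) * mulx u2 i + RtoC (- a / 4) * u1 i) i) i)
    (expseq (-2)) n).
  { rewrite !conv_lin_l. by_parts; field. }
  apply conv_ext; [|reflexivity]. intros [|i] _; unfold twisted_conj, u2, u1, deriv, mulx;
    rewrite ?S_INR; simpl INR; by_parts; field.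
Qed.

(** * The polynomials [U_k] *)

Definition ucoef (a : R) (k i : nat) : R :=
  ((-1) ^ i / INR (fact i) * poch (a - INR k + 1) i * poch (- INR k) i)%R.

(** The coefficients of [sum_i ucoef a k i (4 x)^(k-i)]. *)
Definition Useq (a : R) (k : nat) : nat -> C := fun n =>
  if Nat.leb n k then RtoC (ucoef a k (k - n) * 4 ^ n) else 0.

Lemma poch_S (a : R) (j : nat) : (poch a (S j) = poch a j * (a + INR j))%R.
Proof. reflexivity. Qed.

(** The coefficient of [x^n] involves [ucoef] at [k + 1 - n], [k - n] and
    [k - n - 1]; each is a polynomial multiple of the product of the two
    Pochhammer symbols [(a-k+1)_(k-n-1)] and [(-k)_(k-n-1)], which leaves
    a polynomial identity.  The top degrees [n = k] and [n = k + 1] are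
    separate since some of these indices leave the range. *)
Lemma twisted_conj_Useq (a : R) (k : nat) : twisted_conj a (Useq a k) = Useq a (S k).
Proof.
  apply functional_extensionality; intros n. unfold twisted_conj.
  destruct (Compare_dec.le_lt_dec n k) as [Hn|Hn].
  2:{ destruct (Nat.eq_dec n (S k)) as [->|Hne].
      - unfold mulx, Useq. rewrite !Nat.leb_refl, !Nat.sub_diag.
        rewrite (proj2 (Nat.leb_gt (S k) k)), (proj2 (Nat.leb_gt (S (S k)) k)) by lia.
        unfold ucoef. simpl. by_parts; field.
      - destruct n as [|n]; [lia|]. unfold mulx, Useq.
        rewrite !(proj2 (Nat.leb_gt _ _)) by lia. cring. }
  (* [j = k - n] indexes the Pochhammer symbols *)
  destruct (Nat.le_exists_sub n k Hn) as [j [-> _]].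
  assert (Hmulx : RtoC 4 * mulx (Useq a (j + n)) n
                = RtoC (ucoef a (j + n) (S j) * 4 ^ n)).
  { destruct n as [|n]; unfold mulx.
    - (* [(-j)_(j+1)] contains the factor 0 *)
      rewrite Nat.add_0_r, Cmult_0_r. f_equal. unfold ucoef. simpl poch at 2.
      cring.
    - unfold Useq. rewrite (proj2 (Nat.leb_le _ _)) by lia.
      replace (j + S n - n)%nat with (S j) by lia. rewrite <- RtoC_mult.
      f_equal. simpl. cring. }
  rewrite Hmulx. unfold Useq.
  rewrite (proj2 (Nat.leb_le n (S (j + n)))), (proj2 (Nat.leb_le n (j + n))) by lia.
  replace (S (j + n) - n)%nat with (S j) by lia.
  replace (j + n - n)%nat with j by lia.
  destruct j as [|j].
  - simpl (0 + n)%nat. rewrite (proj2 (Nat.leb_gt (S n) n)) by lia.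
    rewrite Cmult_0_r, Cplus_0_r. rewrite <- RtoC_mult, <- RtoC_plus. f_equal.
    unfold ucoef. rewrite S_INR. simpl. field.
  - rewrite (proj2 (Nat.leb_le (S n) (S j + n))) by lia.
    replace (S j + n - S n)%nat with j by lia.
    rewrite <- !RtoC_mult, <- !RtoC_plus. f_equal.
    unfold ucoef. rewrite !fact_S.
    rewrite (poch_S_l (a - INR (S (S j + n)) + 1)), (poch_S_l (- INR (S (S j + n)))).
    replace (a - INR (S (S j + n)) + 1 + 1)%R with (a - INR (S j + n) + 1)%R
      by (rewrite S_INR; cring).
    replace (- INR (S (S j + n)) + 1)%R with (- INR (S j + n))%R
      by (rewrite (S_INR (S j + n)); cring).
    rewrite !poch_S. generalize (poch (a - INR (S j + n) + 1) j) as P.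
    generalize (poch (- INR (S j + n)) j) as Q. intros Q P.
    rewrite <- !tech_pow_Rmult.
    rewrite !S_INR, !plus_INR, !S_INR.
    pose proof (pos_INR j). pose proof (fact_pos j). field. lra.
Qed.

(** [exp(-D/2) (x^k exp(-x)) = 2^(-a) U_k exp(-2x)], by induction on [k]:
    both sides satisfy the same recursion. *)
Lemma is_exp_besselD_monomial (a : R) (k : nat) :
  is_exp_besselD a (conv (delta k) (expseq (-1)))
    (fun n => RtoC (Rpower 2 (- a)) * conv (Useq a k) (expseq (-2)) n).
Proof.
  rewrite conv_delta. induction k as [|k IH].
  - simpl Nat.iter. intros n.
    eapply is_Cseries_ext; [apply is_exp_besselD_expseq|reflexivity|].
    cbv beta. f_equal. transitivity (conv (delta 0) (expseq (-2)) n);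
      [now rewrite conv_delta|].
    apply conv_ext; [|reflexivity]. intros [|i] _; unfold Useq, delta; simpl;
      [|reflexivity]. f_equal. unfold ucoef. simpl. field.
  - simpl Nat.iter. intros n.
    eapply is_Cseries_ext; [apply is_exp_besselD_mulx, IH|reflexivity|].
    rewrite <- twisted_conj_Useq, <- besselD_conj_conv. unfold besselD_conj.
    destruct n; unfold mulx; cring.
Qed.

(** * Products in the ring of power series *)

Lemma sps_ext (f g : sps) : (forall m a b, f m a b = g m a b) -> f = g.
Proof.
  intros H. apply functional_extensionality; intros m.
  apply functional_extensionality; intros a.
  apply functional_extensionality; intros b. apply H.
Qed.

Lemma cauchy_0_l (v : nat -> nat -> C) (a b : nat) :
  cauchy (fun _ _ => RtoC 0) v a b = 0.
Proof. unfold cauchy. apply csum_0; intros. apply csum_0; intros. ring. Qed.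

Lemma csum_delta (w : nat -> C) (k n : nat) :
  sum_n (fun i => delta k i * w i) n = if Nat.leb k n then w k else RtoC 0.
Proof.
  unfold delta. induction n as [|n IH].
  - rewrite sum_O. destruct k; simpl; cring.
  - rewrite csum_S, IH. destruct (Nat.eqb_spec (S n) k) as [<-|Hne].
    + rewrite Nat.leb_refl, (proj2 (Nat.leb_gt _ _)) by lia. cring.
    + destruct (Nat.leb_spec k n); destruct (Nat.leb_spec k (S n)); try lia; cring.
Qed.

Lemma cauchy_monomial (k l : nat) (v : nat -> nat -> C) (a b : nat) :
  cauchy (fun i j => delta k i * delta l j) v a b
  = if (Nat.leb k a && Nat.leb l b)%bool then v (a - k)%nat (b - l)%nat else 0.
Proof.
  unfold cauchy.
  transitivity (sum_n (fun i => delta k i *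
    (if Nat.leb l b then v (a - i)%nat (b - l)%nat else 0)) a).
  - apply sum_n_ext. intros i.
    rewrite <- (csum_delta (fun j => v (a - i)%nat (b - j)%nat)).
    rewrite <- csum_mult_l. apply sum_n_ext. intros j. cring.
  - rewrite csum_delta. destruct (Nat.leb k a), (Nat.leb l b); reflexivity.
Qed.

Definition mono (m : oddmon) (k l : nat) : sps := fun m' a b =>
  match m, m' with
  | th1, th1 | th3, th3 | th4, th4 | th34, th34 => delta k a * delta l b
  | _, _ => 0
  end.

Definition cshift (k l : nat) (v : nat -> nat -> C) : nat -> nat -> C := fun a b =>
  if (Nat.leb k a && Nat.leb l b)%bool then v (a - k)%nat (b - l)%nat else 0.

Lemma mono_mul (m : oddmon) (k l : nat) (f : sps) (m' : oddmon) (a b : nat) :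
  (mono m k l * f)%S m' a b
  = match m, m' with
    | th1, _ => cshift k l (f m') a b
    | th3, th3 => cshift k l (f th1) a b
    | th3, th34 => cshift k l (f th4) a b
    | th4, th4 => cshift k l (f th1) a b
    | th4, th34 => - cshift k l (f th3) a b
    | th34, th34 => cshift k l (f th1) a b
    | _, _ => 0
    end.
Proof.
  destruct m, m'; unfold smul, mono; rewrite ?cauchy_0_l, ?cauchy_monomial;
    fold (cshift k l (f th1) a b) (cshift k l (f th3) a b)
         (cshift k l (f th4) a b) (cshift k l (f th34) a b); ring.
Qed.

Lemma x1_mono : x1 = mono th1 1 0.
Proof.
  apply sps_ext; intros [] [|[|a]] [|b]; unfold x1, mono, delta; simpl; ring.
Qed.
Lemma x2_mono : x2 = mono th1 0 1.
Proof.
  apply sps_ext; intros [] [|a] [|[|b]]; unfold x2, mono, delta; simpl; ring.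
Qed.
Lemma x3_mono : x3 = mono th3 0 0.
Proof.
  apply sps_ext; intros [] [|a] [|b]; unfold x3, mono, delta; simpl; ring.
Qed.
Lemma x4_mono : x4 = mono th4 0 0.
Proof.
  apply sps_ext; intros [] [|a] [|b]; unfold x4, mono, delta; simpl; ring.
Qed.

Lemma cshift_delta (k l k' l' a b : nat) :
  cshift k l (fun i j => delta k' i * delta l' j) a b
  = delta (k + k') a * delta (l + l') b.
Proof.
  unfold cshift, delta.
  destruct (Nat.leb_spec k a); destruct (Nat.leb_spec l b); simpl;
    destruct (Nat.eqb_spec a (k + k')); destruct (Nat.eqb_spec b (l + l'));
    try lia; try ring;
    destruct (Nat.eqb_spec (a - k) k'); destruct (Nat.eqb_spec (b - l) l');
    try lia; ring.
Qed.

Lemma cshift_0 (k l a b : nat) : cshift k l (fun _ _ => RtoC 0) a b = 0.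
Proof. unfold cshift. now destruct (_ && _)%bool. Qed.

Lemma mono_mul_mono1 (k l : nat) (m : oddmon) (k' l' : nat) :
  (mono th1 k l * mono m k' l')%S = mono m (k + k') (l + l').
Proof.
  apply sps_ext; intros m' a b. rewrite mono_mul. unfold mono.
  destruct m, m'; rewrite ?cshift_0, ?cshift_delta; reflexivity.
Qed.

Lemma x3_mul_x4 : (x3 * x4)%S = mono th34 0 0.
Proof.
  rewrite x3_mono, x4_mono. apply sps_ext; intros m' a b. rewrite mono_mul.
  unfold mono. destruct m'; rewrite ?cshift_0, ?cshift_delta; reflexivity.
Qed.

Lemma sconst_1_mono : sconst 1 = mono th1 0 0.
Proof.
  apply sps_ext; intros [] [|a] [|b]; unfold sconst, mono, delta; simpl; ring.
Qed.

Lemma x2_sqr : (x2 ^ 2)%S = mono th1 0 2.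
Proof. simpl. now rewrite sconst_1_mono, x2_mono, !mono_mul_mono1. Qed.

Lemma x1_pow (k : nat) : (x1 ^ k)%S = mono th1 k 0.
Proof.
  induction k as [|k IH]; [apply sconst_1_mono|].
  simpl. rewrite IH, x1_mono, mono_mul_mono1. reflexivity.
Qed.

Lemma cauchy_scal_l (c : C) (u v : nat -> nat -> C) (a b : nat) :
  cauchy (fun i j => c * u i j) v a b = c * cauchy u v a b.
Proof.
  unfold cauchy. rewrite <- csum_mult_l. apply sum_n_ext; intros.
  rewrite <- csum_mult_l. apply sum_n_ext; intros. cring.
Qed.

Lemma smul_scal_l (c : C) (f g : sps) : ((c *: f) * g)%S = (c *: (f * g))%S.
Proof.
  apply sps_ext; intros [] a b; unfold smul, sscal; rewrite !cauchy_scal_l; ring.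
Qed.

Lemma cauchy_add_l (u u' v : nat -> nat -> C) (a b : nat) :
  cauchy (fun i j => u i j + u' i j) v a b = cauchy u v a b + cauchy u' v a b.
Proof.
  unfold cauchy. rewrite <- csum_plus. apply sum_n_ext; intros.
  rewrite <- csum_plus. apply sum_n_ext; intros. cring.
Qed.

Lemma smul_add_l (f f' g : sps) : ((f + f') * g)%S = (f * g + f' * g)%S.
Proof.
  apply sps_ext; intros [] a b; unfold smul, sadd; rewrite !cauchy_add_l; ring.
Qed.

(** * The sum of the two Bessel operators *)

(** The Euler field [x3 d3 + x4 d4] acts on the monomial [m] as this
    scalar. *)
Definition odd_deg (m : oddmon) : R :=
  match m with th1 => 0 | th3 | th4 => 1 | th34 => 2 end.

(** The sum of the Bessel operators in coefficients.  The independent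
    parameters make the family stable under the exchange of [x1] and
    [x2]. *)
Definition besselT (l1 l2 m1 m2 : R) (f : sps) : sps := fun m a b =>
  RtoC ((INR a + 1) * (INR a + odd_deg m - l1)) * f m (S a) b
  + RtoC ((INR b + 1) * (INR b + odd_deg m - l2)) * f m a (S b)
  + match m with
    | th1 => RtoC (2 * m1) * mulx (fun i => f th34 i b) a
             + RtoC (2 * m2) * mulx (fun j => f th34 a j) b
    | _ => 0
    end.

Lemma bessel_besselT (alpha lam : R) (f : sps) :
  (bessel1 alpha lam f + bessel2 alpha lam f)%S
  = besselT lam (lam / alpha) 1 alpha f.
Proof.
  apply sps_ext; intros m a b. unfold bessel1, bessel2, besselT, sadd, sscal, sopp.
  rewrite x1_mono, x2_mono, x3_mono, x4_mono, !mono_mul. unfold cshift.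
  rewrite !Nat.sub_0_r. simpl Nat.leb. cbn [andb].
  destruct m, a as [|a], b as [|b]; cbn [mulx d1 d2 d3 d4 Nat.leb andb odd_deg];
    unfold d1, d2; simpl Nat.sub; rewrite ?Nat.sub_0_r, ?S_INR; simpl (INR 0);
    unfold d1, d2; rewrite ?S_INR; simpl (INR 0); by_parts; ring.
Qed.

(** * Reduction modulo the ideal *)

Definition red1 (f : sps) : nat -> C := fun n => f th1 n O.
(** [x1^(n-1) x3 x4 = -2 mu x1^n x2] modulo the ideal. *)
Definition red2 (mu : R) (f : sps) : nat -> C := fun n =>
  f th1 n 1%nat + RtoC (- 2 * mu) * mulx (fun i => f th34 i O) n.
Definition red3 (f : sps) : nat -> C := fun n => f th3 n O.
Definition red4 (f : sps) : nat -> C := fun n => f th4 n O.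

(** [f] is congruent to [u1(x1) + u2(x1) x2 + u3(x1) x3 + u4(x1) x4]. *)
Definition has_red (mu : R) (f : sps) (u1 u2 u3 u4 : nat -> C) : Prop :=
  forall n, red1 f n = u1 n /\ red2 mu f n = u2 n
            /\ red3 f n = u3 n /\ red4 f n = u4 n.

Lemma cauchy_col0 (u v : nat -> nat -> C) (n : nat) :
  cauchy u v n 0 = conv (fun i => u i O) (fun i => v i O) n.
Proof. apply sum_n_ext; intros. rewrite sum_O. reflexivity. Qed.

Lemma cauchy_col1 (u v : nat -> nat -> C) (n : nat) :
  cauchy u v n 1 = conv (fun i => u i O) (fun i => v i 1%nat) n
                   + conv (fun i => u i 1%nat) (fun i => v i O) n.
Proof.
  unfold conv. rewrite <- csum_plus. apply sum_n_ext; intros.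
  rewrite csum_S, sum_O. reflexivity.
Qed.

(** The product in the quotient ring: [x2^2], [x2 x3], [x2 x4] vanish and
    [x3 x4] is [-2 mu x1 x2]. *)
Lemma has_red_mul (mu : R) (f g : sps) (u1 u2 u3 u4 v1 v2 v3 v4 : nat -> C) :
  has_red mu f u1 u2 u3 u4 -> has_red mu g v1 v2 v3 v4 ->
  has_red mu (f * g)%S
    (conv u1 v1)
    (fun n => conv u1 v2 n + conv u2 v1 n
       + RtoC (- 2 * mu) * (mulx (conv u3 v4) n - mulx (conv u4 v3) n))
    (fun n => conv u1 v3 n + conv u3 v1 n)
    (fun n => conv u1 v4 n + conv u4 v1 n).
Proof.
  intros Hf Hg n.
  assert (Hc : forall w w' z z' : nat -> C,
            (forall i, w i = w' i) -> (forall i, z i = z' i) ->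
            forall i, conv w' z' i = conv w z i)
    by (intros; apply conv_ext; intros; auto).
  assert (Hc' : forall w w' z z' : nat -> C,
            (forall i, w i = w' i) -> (forall i, z i = z' i) ->
            mulx (conv w' z') n = mulx (conv w z) n).
  { intros. destruct n; [reflexivity|]. simpl. now apply Hc. }
  rewrite (Hc (red1 f) u1 (red1 g) v1), (Hc (red1 f) u1 (red3 g) v3),
    (Hc (red1 f) u1 (red4 g) v4), (Hc (red1 f) u1 (red2 mu g) v2),
    (Hc (red2 mu f) u2 (red1 g) v1), (Hc (red3 f) u3 (red1 g) v1),
    (Hc (red4 f) u4 (red1 g) v1), (Hc' (red3 f) u3 (red4 g) v4),
    (Hc' (red4 f) u4 (red3 g) v3)
    by (intros; first [apply Hf | apply Hg]).
  split; [apply cauchy_col0|].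
  split; [|split; unfold red3, red4, smul; rewrite !cauchy_col0; reflexivity].
  unfold red2. simpl smul at 1. cbv beta.
  rewrite cauchy_col1.
  replace (conv (red1 f) (fun i => g th1 i 1%nat
             + RtoC (-2 * mu) * mulx (fun j => g th34 j O) i) n)
    with (conv (red1 f) (fun i => 1 * g th1 i 1%nat
             + RtoC (-2 * mu) * mulx (fun j => g th34 j O) i) n)
    by (apply conv_ext; intros; ring).
  replace (conv (fun i => f th1 i 1%nat
             + RtoC (-2 * mu) * mulx (fun j => f th34 j O) i) (red1 g) n)
    with (conv (fun i => 1 * f th1 i 1%nat
             + RtoC (-2 * mu) * mulx (fun j => f th34 j O) i) (red1 g) n)
    by (apply conv_ext; intros; ring).
  rewrite conv_lin_l, conv_lin_r, conv_mulx_l, conv_mulx_r.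
  assert (H34 : mulx (fun i => smul f g th34 i O) n
    = mulx (conv (red1 f) (fun i => g th34 i O)) n
      + mulx (conv (fun i => f th34 i O) (red1 g)) n
      + mulx (conv (red3 f) (red4 g)) n - mulx (conv (red4 f) (red3 g)) n).
  { destruct n as [|n]; [simpl; ring|]. unfold smul. cbn [mulx].
    rewrite !cauchy_col0. reflexivity. }
  rewrite H34. unfold red1. ring.
Qed.

Lemma has_red_ext (mu : R) (f : sps) (u1 u2 u3 u4 v1 v2 v3 v4 : nat -> C) :
  has_red mu f u1 u2 u3 u4 ->
  (forall n, u1 n = v1 n) -> (forall n, u2 n = v2 n) ->
  (forall n, u3 n = v3 n) -> (forall n, u4 n = v4 n) ->
  has_red mu f v1 v2 v3 v4.
Proof.
  intros Hf H1 H2 H3 H4 n. rewrite <- H1, <- H2, <- H3, <- H4. apply Hf.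
Qed.

Lemma has_red_add (mu : R) (f g : sps) (u1 u2 u3 u4 v1 v2 v3 v4 : nat -> C) :
  has_red mu f u1 u2 u3 u4 -> has_red mu g v1 v2 v3 v4 ->
  has_red mu (f + g)%S (fun n => u1 n + v1 n) (fun n => u2 n + v2 n)
    (fun n => u3 n + v3 n) (fun n => u4 n + v4 n).
Proof.
  intros Hf Hg n. destruct (Hf n) as (<- & <- & <- & <-).
  destruct (Hg n) as (<- & <- & <- & <-). unfold red1, red2, red3, red4, sadd.
  repeat split. destruct n; simpl; ring.
Qed.

Lemma has_red_scal (mu : R) (c : C) (f : sps) (u1 u2 u3 u4 : nat -> C) :
  has_red mu f u1 u2 u3 u4 ->
  has_red mu (c *: f)%S (fun n => c * u1 n) (fun n => c * u2 n)
    (fun n => c * u3 n) (fun n => c * u4 n).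
Proof.
  intros Hf n. destruct (Hf n) as (<- & <- & <- & <-).
  unfold red1, red2, red3, red4, sscal. repeat split. destruct n; simpl; ring.
Qed.

Lemma has_red_opp (mu : R) (f : sps) (u1 u2 u3 u4 : nat -> C) :
  has_red mu f u1 u2 u3 u4 ->
  has_red mu (- f)%S (fun n => - u1 n) (fun n => - u2 n)
    (fun n => - u3 n) (fun n => - u4 n).
Proof.
  intros Hf n. destruct (Hf n) as (<- & <- & <- & <-).
  unfold red1, red2, red3, red4, sopp. repeat split. destruct n; simpl; ring.
Qed.

Definition zseq : nat -> C := fun _ => 0.
Definition in_ker (mu : R) (f : sps) : Prop := has_red mu f zseq zseq zseq zseq.

Lemma mulx_0 (u : nat -> C) (n : nat) : (forall i, u i = 0) -> mulx u n = 0.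
Proof. intros Hu. destruct n; [reflexivity|apply Hu]. Qed.

Lemma red_self (mu : R) (f : sps) :
  has_red mu f (red1 f) (red2 mu f) (red3 f) (red4 f).
Proof. intros n. auto. Qed.

Lemma in_ker_mul_l (mu : R) (h f : sps) : in_ker mu f -> in_ker mu (h * f)%S.
Proof.
  intros Hf. eapply has_red_ext; [exact (has_red_mul _ _ _ _ _ _ _ _ _ _ _
    (red_self mu h) Hf)| | | |]; intros n; cbv beta;
    rewrite ?mulx_0 by apply conv_0_r; unfold zseq; rewrite !conv_0_r; ring.
Qed.

Lemma in_ker_mul_r (mu : R) (h f : sps) : in_ker mu f -> in_ker mu (f * h)%S.
Proof.
  intros Hf. eapply has_red_ext; [exact (has_red_mul _ _ _ _ _ _ _ _ _ _ _
    Hf (red_self mu h))| | | |]; intros n; cbv beta;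
    rewrite ?mulx_0 by apply conv_0_l; unfold zseq; rewrite !conv_0_l; ring.
Qed.

Lemma in_ker_add (mu : R) (f g : sps) :
  in_ker mu f -> in_ker mu g -> in_ker mu (f + g)%S.
Proof.
  intros Hf Hg. eapply has_red_ext; [exact (has_red_add _ _ _ _ _ _ _ _ _ _ _
    Hf Hg)| | | |]; intros n; unfold zseq; ring.
Qed.

Lemma in_ker_0 (mu : R) : in_ker mu (sconst 0).
Proof.
  intros [|[|n]]; unfold red1, red2, red3, red4, zseq, sconst, mulx;
    repeat split; ring.
Qed.

Definition even_series (u : nat -> nat -> C) : sps := fun m a b =>
  match m with th1 => u a b | _ => 0 end.

(** The four multipliers can be read off: the component of [x3 x4] is
    cancelled by the first generator, after which all remaining terms are
    divisible by [x2^2], [x2 x3] or [x2 x4]. *)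
Lemma in_ker_decomp (mu : R) (f : sps) : in_ker mu f ->
  exists u v w z : sps,
    f = ((RtoC (2 * mu) *: (x1 * x2) + x3 * x4) * u + x2 ^ 2 * v
         + (x2 * x3) * w + (x2 * x4) * z)%S.
Proof.
  intros Hf.
  exists (even_series (fun a b => f th34 a b)).
  exists (even_series (fun a b => f th1 a (S (S b))
            + RtoC (- 2 * mu) * mulx (fun i => f th34 i (S b)) a)).
  exists (even_series (fun a b => f th3 a (S b))).
  exists (even_series (fun a b => f th4 a (S b))).
  rewrite x3_mul_x4, x2_sqr, x1_mono, x2_mono, x3_mono, x4_mono, !mono_mul_mono1.
  apply sps_ext; intros m a b. unfold sadd at 1 2 3.
  rewrite smul_add_l, smul_scal_l. unfold sadd, sscal.
  rewrite !mono_mul. simpl Nat.add.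
  destruct (Hf a) as (H1 & H2 & H3 & H4). unfold red1, red2, red3, red4, zseq in *.
  assert (H2' : f th1 a 1%nat = RtoC (2 * mu) * mulx (fun i => f th34 i O) a).
  { transitivity (f th1 a 1%nat + RtoC (-2 * mu) * mulx (fun i => f th34 i O) a
                  + RtoC (2 * mu) * mulx (fun i => f th34 i O) a);
      [by_parts; ring|]. rewrite H2. ring. }
  unfold cshift. rewrite !Nat.sub_0_r. simpl Nat.leb. cbn [andb].
  destruct m, b as [|[|b]]; cbn [even_series Nat.leb andb Nat.sub];
    rewrite ?H1, ?H2', ?H3, ?H4, ?Nat.sub_0_r;
    destruct a as [|a]; cbn [even_series Nat.leb andb Nat.sub mulx] in *;
    rewrite ?Nat.sub_0_r; by_parts; ring.
Qed.

(** * The exponential on reduced series *)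

(** That the reduction is respected is the identity
    [(n+1)(n-a) = n(n+1-a) - a] between the actions on [x1^(n+1) x2] and on
    [x1^n x3 x4]. *)
Lemma has_red_besselT (a mu : R) (f : sps) (u1 u2 u3 u4 : nat -> C) :
  has_red mu f u1 u2 u3 u4 ->
  has_red mu (besselT a 1 mu (a * mu) f)
    (fun n => besselD a u1 n - u2 n) (besselD a u2)
    (besselD (a - 1) u3) (besselD (a - 1) u4).
Proof.
  intros Hf n. unfold besselD.
  destruct (Hf n) as (E1 & E2 & E3 & E4).
  destruct (Hf (S n)) as (<- & <- & <- & <-). rewrite <- E2.
  unfold red1, red2, red3, red4, besselT, odd_deg.
  repeat split; destruct n as [|n]; cbn [mulx]; rewrite ?S_INR;
    simpl INR; by_parts; ring.
Qed.

(** The nilpotent map [(u1, u2) |-> (- u2, 0)] commutes with [D], so the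
    binomial expansion of [T^j] stops after two terms. *)
Lemma has_red_iter_besselT (a mu : R) (f : sps) (u1 u2 u3 u4 : nat -> C) (j : nat) :
  has_red mu f u1 u2 u3 u4 ->
  has_red mu (Nat.iter j (besselT a 1 mu (a * mu)) f)
    (fun n => Nat.iter j (besselD a) u1 n
       + match j with
         | O => 0
         | S i => - RtoC (INR j) * Nat.iter i (besselD a) u2 n
         end)
    (Nat.iter j (besselD a) u2)
    (Nat.iter j (besselD (a - 1)) u3) (Nat.iter j (besselD (a - 1)) u4).
Proof.
  intros Hf; induction j as [|j IH].
  - eapply has_red_ext; [exact Hf| | | |]; intros n; simpl; ring.
  - eapply has_red_ext; [exact (has_red_besselT _ _ _ _ _ _ _ IH)| | | |];
      intros n; [|reflexivity..].
    cbv beta. unfold besselD at 1. rewrite S_INR.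
    destruct j as [|j].
    + simpl. unfold besselD. by_parts; ring.
    + change (Nat.iter (S (S j)) (besselD a) u1 n) with
        (RtoC ((INR n + 1) * (INR n - a)) * Nat.iter (S j) (besselD a) u1 (S n)).
      change (Nat.iter (S j) (besselD a) u2 n) with
        (RtoC ((INR n + 1) * (INR n - a)) * Nat.iter j (besselD a) u2 (S n)).
      by_parts; ring.
Qed.

(** [F = exp(-T/2) f], coefficient by coefficient. *)
Definition is_exp_besselT (l1 l2 m1 m2 : R) (f F : sps) : Prop := forall m a b,
  is_Cseries (fun j => RtoC (exp_half j) * Nat.iter j (besselT l1 l2 m1 m2) f m a b)
    (F m a b).

(** Each component of the reduction is a finite combination of
    coefficients, so it commutes with the sum; the terms [- j D^(j-1) u2]
    sum to [exp(-D/2) u2 / 2]. *)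
Lemma has_red_exp_besselT (a mu : R) (f F : sps)
  (u1 u2 u3 u4 h1 h2 h3 h4 : nat -> C) :
  is_exp_besselT a 1 mu (a * mu) f F -> has_red mu f u1 u2 u3 u4 ->
  is_exp_besselD a u1 h1 -> is_exp_besselD a u2 h2 ->
  is_exp_besselD (a - 1) u3 h3 -> is_exp_besselD (a - 1) u4 h4 ->
  has_red mu F (fun n => h1 n + RtoC (1 / 2) * h2 n) h2 h3 h4.
Proof.
  intros HF Hf H1 H2 H3 H4 n.
  pose proof (fun j => has_red_iter_besselT a mu f u1 u2 u3 u4 j Hf n) as HT.
  repeat split.
  - apply is_Cseries_unique with (1 := HF th1 n O).
    eapply is_Cseries_ext;
      [exact (is_Cseries_plus _ _ _ _ (H1 n)
         (is_Cseries_mulx _ _ (is_Cseries_scal (RtoC (1 / 2)) _ _ (H2 n))))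
      | |reflexivity].
    intros j. cbv beta.
    change (Nat.iter j (besselT a 1 mu (a * mu)) f th1 n O)
      with (red1 (Nat.iter j (besselT a 1 mu (a * mu)) f) n).
    rewrite (proj1 (HT j)).
    destruct j as [|j]; [simpl; ring|]. cbn [mulx]. rewrite S_INR.
    replace (exp_half j) with (- 2 * (exp_half (S j) * (INR j + 1)))%R
      by (rewrite exp_half_S; field).
    by_parts; field.
  - apply is_Cseries_unique with (2 := H2 n).
    unfold red2.
    eapply is_Cseries_ext;
      [apply is_Cseries_plus; [exact (HF th1 n 1%nat)|];
       apply (is_Cseries_scal (RtoC (-2 * mu)))| |reflexivity].
    + instantiate (1 := fun j => mulx (fun i => RtoC (exp_half j)
         * Nat.iter j (besselT a 1 mu (a * mu)) f th34 i O) n).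
      destruct n as [|n]; [apply is_Cseries_0|exact (HF th34 n O)].
    + intros j. cbv beta. destruct (HT j) as (_ & <- & _). unfold red2.
      destruct n; cbn [mulx]; ring.
  - apply is_Cseries_unique with (2 := H3 n).
    eapply is_Cseries_ext; [exact (HF th3 n O)| |reflexivity].
    intros j. cbv beta. destruct (HT j) as (_ & _ & <- & _). reflexivity.
  - apply is_Cseries_unique with (2 := H4 n).
    eapply is_Cseries_ext; [exact (HF th4 n O)| |reflexivity].
    intros j. cbv beta. destruct (HT j) as (_ & _ & _ & <-). reflexivity.
Qed.

(** * Convergence in the full ring *)

Lemma Cmod_sum_n (u : nat -> C) (n : nat) :
  (Cmod (sum_n u n) <= sum_n (fun i => Cmod (u i)) n)%R.
Proof.
  induction n as [|n IH].
  - rewrite !sum_O. apply Rle_refl.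
  - rewrite csum_S, sum_Sn. eapply Rle_trans; [apply Cmod_triangle|].
    apply Rplus_le_compat_r, IH.
Qed.

Lemma rsum_mult_l (c : R) (u : nat -> R) (n : nat) :
  sum_n (fun i => c * u i)%R n = (c * sum_n u n)%R.
Proof. exact (sum_n_mult_l (K := R_Ring) c u n). Qed.

Definition exp_coef (e : R) (n : nat) : R := (e ^ n / INR (fact n))%R.

Lemma exp_coef_pos (e : R) (n : nat) : (0 < e -> 0 < exp_coef e n)%R.
Proof. intros He. apply Rdiv_lt_0_compat; [now apply pow_lt|apply fact_pos]. Qed.

(** [exp(x) exp(e x) = exp((1+e) x)] in coefficients. *)
Lemma exp_coef_conv (e : R) (n : nat) :
  sum_n (fun i => exp_coef 1 i * exp_coef e (n - i))%R n = exp_coef (1 + e) n.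
Proof.
  unfold exp_coef at 3. rewrite binomial, <- sum_n_Reals. unfold Rdiv.
  rewrite Rmult_comm.
  rewrite <- rsum_mult_l. apply sum_n_ext_loc; intros i Hi.
  unfold Binomial.C, exp_coef, mult; simpl. rewrite pow1.
  pose proof (fact_pos n). pose proof (fact_pos i). pose proof (fact_pos (n - i)).
  field. lra.
Qed.

Lemma cauchy_exp_bound (u v : nat -> nat -> C) (Q e : R) :
  (forall i j, Cmod (u i j) <= exp_coef 1 i * exp_coef 1 j)%R ->
  (forall i j, Cmod (v i j) <= Q * (exp_coef e i * exp_coef e j))%R ->
  forall a b, (Cmod (cauchy u v a b) <= Q * (exp_coef (1 + e) a * exp_coef (1 + e) b))%R.
Proof.
  intros Hu Hv a b. unfold cauchy.
  assert (Hle : forall (f g : nat -> R) n, (forall i, f i <= g i)%R ->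
            (sum_n f n <= sum_n g n)%R)
    by (intros; now apply sum_n_m_le).
  eapply Rle_trans; [apply Cmod_sum_n|].
  eapply Rle_trans.
  { apply Hle. intros i. eapply Rle_trans; [apply Cmod_sum_n|]. apply Hle.
    intros j. rewrite Cmod_mult.
    apply Rmult_le_compat; [apply Cmod_ge_0|apply Cmod_ge_0|apply Hu|apply Hv]. }
  right. rewrite <- !exp_coef_conv.
  transitivity (sum_n (fun i => (Q * sum_n (fun j => exp_coef 1 j * exp_coef e (b - j)) b)
                        * (exp_coef 1 i * exp_coef e (a - i)))%R a).
  - apply sum_n_ext; intros i.
    transitivity (sum_n (fun j => (Q * (exp_coef 1 i * exp_coef e (a - i)))
                           * (exp_coef 1 j * exp_coef e (b - j)))%R b).
    + apply sum_n_ext; intros j. cring.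
    + rewrite rsum_mult_l. cring.
  - rewrite rsum_mult_l. cring.
Qed.

Lemma finite_bound (P : nat -> R -> Prop) (N : nat) :
  (forall n M M', P n M -> M <= M' -> P n M')%R ->
  (forall n, exists M, 0 <= M /\ P n M)%R ->
  exists M, (0 <= M /\ forall n, (n < N)%nat -> P n M)%R.
Proof.
  intros Hmon Hex. induction N as [|N [M [HM0 HM]]].
  - exists 0%R. split; [lra|lia].
  - destruct (Hex N) as [M' [HM0' HM']]. exists (M + M')%R. split; [lra|].
    intros n Hn. destruct (Nat.eq_dec n N) as [->|Hne].
    + apply Hmon with M'; [exact HM'|lra].
    + apply Hmon with M; [apply HM; lia|lra].
Qed.

(** A polynomial is dominated by a multiple of [exp(e (x1 + x2))] for every
    [e > 0]; small [e] keeps the growth rate of [exp(-x1-x2) p] near [1]. *)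
Lemma poly_exp_bound (p : sps) (e : R) : is_poly p -> (0 < e)%R ->
  exists Q, (0 <= Q)%R /\
    forall m i j, (Cmod (p m i j) <= Q * (exp_coef e i * exp_coef e j))%R.
Proof.
  intros [N HN] He.
  assert (Hw : forall i j, (0 < exp_coef e i * exp_coef e j)%R)
    by (intros; apply Rmult_lt_0_compat; now apply exp_coef_pos).
  assert (Hmon : forall (x w M M' : R),
            (0 < w -> x <= M * w -> M <= M' -> x <= M' * w)%R) by (intros; nra).
  destruct (finite_bound (fun i M => forall j, (j < N)%nat -> forall m,
              Cmod (p m i j) <= M * (exp_coef e i * exp_coef e j))%R N) as [Q [HQ0 HQ]].
  - intros i M M' HP HM j Hj m. eapply Hmon; eauto.
  - intros i. apply finite_bound.
    + intros j M M' HP HM m. eapply Hmon; eauto.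
    + intros j. specialize (Hw i j). set (w := (exp_coef e i * exp_coef e j)%R) in *.
      exists ((Cmod (p th1 i j) + Cmod (p th3 i j) + Cmod (p th4 i j)
               + Cmod (p th34 i j)) / w)%R.
      pose proof (Cmod_ge_0 (p th1 i j)). pose proof (Cmod_ge_0 (p th3 i j)).
      pose proof (Cmod_ge_0 (p th4 i j)). pose proof (Cmod_ge_0 (p th34 i j)).
      split; [apply Rdiv_le_0_compat; lra|].
      intros m. replace (_ / w * w)%R with (Cmod (p th1 i j) + Cmod (p th3 i j)
        + Cmod (p th4 i j) + Cmod (p th34 i j))%R by (field; lra).
      destruct m; lra.
  - exists Q. split; [exact HQ0|]. intros m i j.
    destruct (Compare_dec.le_lt_dec N (i + j)) as [Hij|Hij].
    + rewrite HN, Cmod_0 by exact Hij. specialize (Hw i j). nra.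
    + apply HQ; lia.
Qed.

Lemma sexp_mul_bound (p : sps) (e : R) : is_poly p -> (0 < e)%R ->
  exists Q, (0 <= Q)%R /\
    forall m a b, (Cmod ((sexp (-1) (-1) * p)%S m a b)
                   <= Q * (exp_coef (1 + e) a * exp_coef (1 + e) b))%R.
Proof.
  intros Hp He. destruct (poly_exp_bound p e Hp He) as [Q [HQ0 HQ]].
  exists Q. split; [exact HQ0|]. intros m a b.
  replace ((sexp (-1) (-1) * p)%S m a b)
    with (cauchy (sexp (-1) (-1) th1) (p m) a b).
  - apply cauchy_exp_bound; [|apply HQ]. intros i j. unfold sexp.
    rewrite Cmod_R, Rabs_mult. unfold exp_coef, Rdiv.
    rewrite !Rabs_mult, !pow_1_abs, !pow1.
    rewrite !(Rabs_pos_eq (/ _)) by apply Rlt_le, Rinv_0_lt_compat, fact_pos. lra.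
  - destruct m; unfold smul; cbn [sexp];
      repeat match goal with |- context [cauchy (sexp ?s ?t ?m) ?v a b] =>
        lazymatch m with th1 => fail | _ =>
        replace (cauchy (sexp s t m) v a b) with (RtoC 0)
          by (symmetry; exact (cauchy_0_l v a b)) end end; ring.
Qed.

Definition odd_degn (m : oddmon) : nat :=
  match m with th1 => 0 | th3 | th4 => 1 | th34 => 2 end.

Definition besselT_shift (l1 l2 : R) : R := (2 + Rabs l1 + Rabs l2)%R.

(** The operator also maps the component of [x3 x4] to the even component.
    Giving the former a small weight makes this map a small perturbation:
    the constant is chosen so that it costs a factor [5/4] at most. *)
Definition odd_weight (m1 m2 : R) (m : oddmon) : R :=
  match m with th34 => / (8 * (1 + Rabs m1 + Rabs m2)) | _ => 1 end%R.

Lemma odd_weight_pos (m1 m2 : R) (m : oddmon) : (0 < odd_weight m1 m2 m)%R.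
Proof.
  pose proof (Rabs_pos m1). pose proof (Rabs_pos m2).
  destruct m; simpl; try lra. apply Rinv_0_lt_compat. lra.
Qed.

Lemma mulx_fact_bound (u : nat -> C) (n : nat) (y : nat -> R) :
  (forall i, Cmod (u i) * INR (fact i) <= y (S i))%R ->
  (Cmod (mulx u n) * INR (fact n) <= INR n * y n)%R.
Proof.
  intros Hu. destruct n as [|n].
  - simpl mulx. rewrite Cmod_0. simpl. lra.
  - cbn [mulx]. rewrite fact_S, S_INR. specialize (Hu n). pose proof (pos_INR n). nra.
Qed.

(** Multiplying the coefficients by [a! b!] turns [x1 d1^2 + x2 d2^2] into
    shifts with factors linear in [a] and [b], so a coefficient of
    the image is bounded by coefficients one degree higher, times a factor
    linear in the degree. *)
Lemma besselT_bound (l1 l2 m1 m2 : R) (f : sps) (w : nat -> R) :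
  let eps := odd_weight m1 m2 in
  (forall n, 0 <= w n)%R ->
  (forall m a b, Cmod (f m a b) * (INR (fact a) * INR (fact b))
                 <= eps m * w (a + b + odd_degn m)%nat)%R ->
  forall m a b,
    (Cmod (besselT l1 l2 m1 m2 f m a b) * (INR (fact a) * INR (fact b))
     <= eps m * (5 / 4 * (INR (a + b + odd_degn m) + besselT_shift l1 l2)
                 * w (S (a + b + odd_degn m))))%R.
Proof.
  intros eps Hw Hf m a b.
  pose proof (fact_pos a) as Fa. pose proof (fact_pos b) as Fb.
  pose proof (pos_INR a) as Ha. pose proof (pos_INR b) as Hb.
  pose proof (Rabs_pos l1) as Hl1. pose proof (Rabs_pos l2) as Hl2.
  pose proof (Rabs_pos m1) as Hm1. pose proof (Rabs_pos m2) as Hm2.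
  pose proof (odd_weight_pos m1 m2 m) as He. fold eps in He.
  set (N := (a + b + odd_degn m)%nat).
  assert (HN : INR N = (INR a + INR b + odd_deg m)%R).
  { unfold N. rewrite !plus_INR. destruct m; simpl; ring. }
  specialize (Hw (S N)). set (W := w (S N)) in *.
  assert (Hd : (0 <= odd_deg m <= 2)%R) by (destruct m; simpl; lra).
  (* [(a+1) a! = (a+1)!] absorbs the first factor of the coefficient *)
  assert (T1 : (Cmod (RtoC ((INR a + 1) * (INR a + odd_deg m - l1)) * f m (S a) b)
                * (INR (fact a) * INR (fact b))
                <= (INR a + odd_deg m + Rabs l1) * (eps m * W))%R).
  { specialize (Hf m (S a) b). rewrite fact_S in Hf.
    replace (S a + b + odd_degn m)%nat with (S N) in Hf by (unfold N; lia).
    fold W in Hf.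
    assert (HA : (Rabs (INR a + odd_deg m - l1) <= INR a + odd_deg m + Rabs l1)%R).
    { unfold Rminus. eapply Rle_trans; [apply Rabs_triang|].
      rewrite Rabs_Ropp, Rabs_pos_eq; lra. }
    rewrite Cmod_mult, Cmod_R, Rabs_mult, (Rabs_pos_eq (INR a + 1)) by lra.
    apply Rle_trans with ((INR a + odd_deg m + Rabs l1)
      * (Cmod (f m (S a) b) * ((INR a + 1) * INR (fact a) * INR (fact b))))%R.
    - replace (_ * _ * _ * _)%R with (Rabs (INR a + odd_deg m - l1)
        * (Cmod (f m (S a) b) * ((INR a + 1) * INR (fact a) * INR (fact b))))%R
        by ring.
      apply Rmult_le_compat_r; [|exact HA].
      apply Rmult_le_pos; [apply Cmod_ge_0|].
      apply Rmult_le_pos; [|lra]. apply Rmult_le_pos; lra.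
    - apply Rmult_le_compat_l; [lra|exact Hf]. }
  assert (T2 : (Cmod (RtoC ((INR b + 1) * (INR b + odd_deg m - l2)) * f m a (S b))
                * (INR (fact a) * INR (fact b))
                <= (INR b + odd_deg m + Rabs l2) * (eps m * W))%R).
  { specialize (Hf m a (S b)). rewrite fact_S in Hf.
    replace (a + S b + odd_degn m)%nat with (S N) in Hf by (unfold N; lia).
    fold W in Hf.
    assert (HA : (Rabs (INR b + odd_deg m - l2) <= INR b + odd_deg m + Rabs l2)%R).
    { unfold Rminus. eapply Rle_trans; [apply Rabs_triang|].
      rewrite Rabs_Ropp, Rabs_pos_eq; lra. }
    rewrite Cmod_mult, Cmod_R, Rabs_mult, (Rabs_pos_eq (INR b + 1)) by lra.
    apply Rle_trans with ((INR b + odd_deg m + Rabs l2)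
      * (Cmod (f m a (S b)) * (INR (fact a) * ((INR b + 1) * INR (fact b)))))%R.
    - replace (_ * _ * _ * _)%R with (Rabs (INR b + odd_deg m - l2)
        * (Cmod (f m a (S b)) * (INR (fact a) * ((INR b + 1) * INR (fact b)))))%R
        by ring.
      apply Rmult_le_compat_r; [|exact HA].
      apply Rmult_le_pos; [apply Cmod_ge_0|].
      apply Rmult_le_pos; [lra|]. apply Rmult_le_pos; lra.
    - apply Rmult_le_compat_l; [lra|exact Hf]. }
  (* the small weight of [x3 x4] makes this at most a quarter of the degree *)
  assert (T3 : (Cmod (match m with
                | th1 => RtoC (2 * m1) * mulx (fun i => f th34 i b) a
                         + RtoC (2 * m2) * mulx (fun j => f th34 a j) b
                | _ => 0 end) * (INR (fact a) * INR (fact b))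
                <= (INR a + INR b) / 4 * (eps m * W))%R).
  { assert (Hz : (0 <= (INR a + INR b) / 4 * (eps m * W))%R)
      by (apply Rmult_le_pos; [lra|]; apply Rmult_le_pos; lra).
    destruct m; try (rewrite Cmod_0, Rmult_0_l; exact Hz). clear Hz.
    simpl odd_degn in N. simpl eps in *.
    set (e34 := (/ (8 * (1 + Rabs m1 + Rabs m2)))%R) in *.
    assert (He34 : (0 < e34)%R) by (apply Rinv_0_lt_compat; lra).
    assert (S1 : (Cmod (mulx (fun i => f th34 i b) a) * INR (fact a)
                  <= INR a * (e34 * w (a + b + 1)%nat / INR (fact b)))%R).
    { apply (mulx_fact_bound _ a (fun a => e34 * w (a + b + 1)%nat / INR (fact b))%R).
      intros i. specialize (Hf th34 i b). simpl odd_degn in Hf.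
      replace (i + b + 2)%nat with (S i + b + 1)%nat in Hf by lia.
      apply Rmult_le_reg_r with (INR (fact b)); [exact Fb|].
      replace (e34 * w (S i + b + 1)%nat / INR (fact b) * INR (fact b))%R
        with (e34 * w (S i + b + 1)%nat)%R by (field; lra).
      rewrite Rmult_assoc. exact Hf. }
    assert (S2 : (Cmod (mulx (fun j => f th34 a j) b) * INR (fact b)
                  <= INR b * (e34 * w (a + b + 1)%nat / INR (fact a)))%R).
    { apply (mulx_fact_bound _ b (fun b => e34 * w (a + b + 1)%nat / INR (fact a))%R).
      intros j. specialize (Hf th34 a j). simpl odd_degn in Hf.
      replace (a + j + 2)%nat with (a + S j + 1)%nat in Hf by lia.
      apply Rmult_le_reg_r with (INR (fact a)); [exact Fa|].
      replace (e34 * w (a + S j + 1)%nat / INR (fact a) * INR (fact a))%R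
        with (e34 * w (a + S j + 1)%nat)%R by (field; lra).
      rewrite Rmult_assoc, (Rmult_comm (INR (fact j))). exact Hf. }
    replace (a + b + 1)%nat with (S N) in S1, S2 by (unfold N; lia).
    fold W in S1, S2.
    apply (Rmult_le_compat_r (INR (fact b))) in S1; [|lra].
    apply (Rmult_le_compat_r (INR (fact a))) in S2; [|lra].
    replace (INR a * (e34 * W / INR (fact b)) * INR (fact b))%R
      with (INR a * (e34 * W))%R in S1 by (field; lra).
    replace (INR b * (e34 * W / INR (fact a)) * INR (fact a))%R
      with (INR b * (e34 * W))%R in S2 by (field; lra).
    eapply Rle_trans.
    { apply Rmult_le_compat_r; [apply Rmult_le_pos; lra|]. apply Cmod_triangle. }
    rewrite !Cmod_mult, !Cmod_R, !Rabs_mult, (Rabs_pos_eq 2) by lra.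
    apply Rle_trans with (2 * Rabs m1 * (INR a * (e34 * W))
                          + 2 * Rabs m2 * (INR b * (e34 * W)))%R.
    - rewrite Rmult_plus_distr_r. apply Rplus_le_compat.
      + replace (_ * _ * _ * _)%R with (2 * Rabs m1
          * (Cmod (mulx (fun i => f th34 i b) a) * INR (fact a) * INR (fact b)))%R
          by ring. apply Rmult_le_compat_l; lra.
      + replace (_ * _ * _ * _)%R with (2 * Rabs m2
          * (Cmod (mulx (fun j => f th34 a j) b) * INR (fact b) * INR (fact a)))%R
          by ring. apply Rmult_le_compat_l; lra.
    - assert (E1 : (2 * Rabs m1 * e34 <= 1 / 4)%R).
      { apply Rmult_le_reg_r with (8 * (1 + Rabs m1 + Rabs m2))%R; [lra|].
        unfold e34. rewrite Rmult_assoc, Rinv_l by lra. lra. }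
      assert (E2 : (2 * Rabs m2 * e34 <= 1 / 4)%R).
      { apply Rmult_le_reg_r with (8 * (1 + Rabs m1 + Rabs m2))%R; [lra|].
        unfold e34. rewrite Rmult_assoc, Rinv_l by lra. lra. }
      apply (Rmult_le_compat_r (INR a * W)) in E1; [|apply Rmult_le_pos; lra].
      apply (Rmult_le_compat_r (INR b * W)) in E2; [|apply Rmult_le_pos; lra].
      lra. }
  unfold besselT.
  apply Rle_trans with ((INR a + odd_deg m + Rabs l1) * (eps m * W)
    + (INR b + odd_deg m + Rabs l2) * (eps m * W)
    + (INR a + INR b) / 4 * (eps m * W))%R.
  - eapply Rle_trans; [|apply Rplus_le_compat; [apply Rplus_le_compat|]; eassumption].
    rewrite <- !Rmult_plus_distr_r.
    apply Rmult_le_compat_r; [apply Rmult_le_pos; lra|].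
    eapply Rle_trans; [apply Cmod_triangle|].
    apply Rplus_le_compat_r, Cmod_triangle.
  - rewrite HN. unfold besselT_shift.
    assert (HWp : (0 <= eps m * W)%R) by (apply Rmult_le_pos; lra).
    replace (eps m * (5 / 4 * (INR a + INR b + odd_deg m + (2 + Rabs l1 + Rabs l2))
               * W))%R
      with (5 / 4 * (INR a + INR b + odd_deg m + (2 + Rabs l1 + Rabs l2))
            * (eps m * W))%R by ring.
    rewrite <- !Rmult_plus_distr_r. apply Rmult_le_compat_r; [exact HWp|]. lra.
Qed.

(** The linear factors of the successive steps multiply up to a Pochhammer
    symbol, of the size of [j!]. *)
Lemma iter_besselT_bound (l1 l2 m1 m2 : R) (f : sps) (Q : R) :
  (0 <= Q)%R ->
  (forall m a b,
     Cmod (f m a b) <= Q * (exp_coef (1 + 1 / 4) a * exp_coef (1 + 1 / 4) b))%R ->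
  exists K, forall j m a b,
    let N := (a + b + odd_degn m)%nat in
    (Cmod (Nat.iter j (besselT l1 l2 m1 m2) f m a b) * (INR (fact a) * INR (fact b))
     <= odd_weight m1 m2 m
        * (K * (5 / 4) ^ j * poch (INR N + besselT_shift l1 l2) j * (5 / 4) ^ (N + j)))%R.
Proof.
  intros HQ Hf. set (K := (Q / odd_weight m1 m2 th34)%R).
  pose proof (odd_weight_pos m1 m2 th34) as He.
  assert (HK : (0 <= K)%R) by (apply Rdiv_le_0_compat; lra).
  assert (Hc : (2 <= besselT_shift l1 l2)%R).
  { unfold besselT_shift. pose proof (Rabs_pos l1). pose proof (Rabs_pos l2). lra. }
  assert (Hw : forall j n,
     (0 <= K * (5 / 4) ^ j * poch (INR n + besselT_shift l1 l2) j * (5 / 4) ^ (n + j))%R).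
  { intros j n. pose proof (pos_INR n).
    apply Rmult_le_pos; [apply Rmult_le_pos; [apply Rmult_le_pos; [exact HK|]|]|];
      [apply pow_le; lra| |apply pow_le; lra].
    apply Rlt_le, poch_pos. lra. }
  exists K. intros j. induction j as [|j IH]; intros m a b N.
  - simpl Nat.iter. simpl poch. rewrite Nat.add_0_r, pow_O, !Rmult_1_r.
    specialize (Hf m a b).
    apply Rle_trans with (Q * (5 / 4) ^ (a + b))%R.
    + apply (Rmult_le_compat_r (INR (fact a) * INR (fact b))) in Hf;
        [|apply Rmult_le_pos; apply Rlt_le, fact_pos].
      eapply Rle_trans; [exact Hf|]. right. unfold exp_coef. rewrite pow_add.
      replace (1 + 1 / 4)%R with (5 / 4)%R by field.
      pose proof (fact_pos a). pose proof (fact_pos b).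
      field. lra.
    + rewrite <- Rmult_assoc. apply Rmult_le_compat; [exact HQ|apply pow_le; lra| |].
      * unfold K. pose proof (Rabs_pos m1). pose proof (Rabs_pos m2).
        assert (Hle : (odd_weight m1 m2 th34 <= odd_weight m1 m2 m)%R).
        { destruct m; try apply Rle_refl; simpl; rewrite <- Rinv_1;
            apply Rinv_le_contravar; lra. }
        apply (Rmult_le_compat_r (Q / odd_weight m1 m2 th34)) in Hle; [|exact HK].
        replace (odd_weight m1 m2 th34 * (Q / odd_weight m1 m2 th34))%R
          with Q in Hle by (field; lra). exact Hle.
      * apply Rle_pow; [lra|]. unfold N. lia.
  - pose proof (besselT_bound l1 l2 m1 m2 _ (fun n => K * (5 / 4) ^ j
        * poch (INR n + besselT_shift l1 l2) j * (5 / 4) ^ (n + j))%R (Hw j) IH m a b)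
      as H. cbv zeta beta in H. fold N in H.
    eapply Rle_trans; [exact H|]. right. rewrite poch_S_l, S_INR.
    replace (N + S j)%nat with (S (N + j)) by lia. simpl pow.
    replace (INR N + 1 + besselT_shift l1 l2)%R with (INR N + besselT_shift l1 l2 + 1)%R
      by ring.
    simpl Nat.add. simpl pow. ring.
Qed.

(** The growth rates [5/4] of the initial series and [5/4] of the weights
    make the terms comparable to those of a binomial series at
    [(5/4)^2 / 2 = 25/32]. *)
Lemma exp_besselT_ex (l1 l2 m1 m2 : R) (p : sps) : is_poly p ->
  exists F, is_exp_besselT l1 l2 m1 m2 (sexp (-1) (-1) * p)%S F.
Proof.
  intros Hp.
  destruct (sexp_mul_bound p (1 / 4) Hp ltac:(lra)) as [Q [HQ0 HQ]].
  destruct (iter_besselT_bound l1 l2 m1 m2 _ Q HQ0 HQ) as [K HK].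
  set (T := besselT l1 l2 m1 m2) in *. set (g := (sexp (-1) (-1) * p)%S) in *.
  assert (Hex : forall m a b, exists l,
            is_Cseries (fun j => RtoC (exp_half j) * Nat.iter j T g m a b) l).
  { intros m a b.
    set (N := (a + b + odd_degn m)%nat). set (B := (INR N + besselT_shift l1 l2)%R).
    set (K' := (odd_weight m1 m2 m * K * (5 / 4) ^ N
                / (INR (fact a) * INR (fact b)))%R).
    pose proof (fact_pos a) as Fa. pose proof (fact_pos b) as Fb.
    apply (ex_series_le (V := C_CompleteNormedModule) _
             (fun j => K' * Rabs (bincoef B j * (25 / 32) ^ j))%R).
    - intros j. specialize (HK j m a b). cbv zeta in HK. fold N B in HK.
      change (Cmod (RtoC (exp_half j) * Nat.iter j T g m a b)
              <= K' * Rabs (bincoef B j * (25 / 32) ^ j))%R.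
      set (z := Nat.iter j T g m a b) in *.
      rewrite Cmod_mult, Cmod_R.
      pose proof (fact_pos j) as Fj. pose proof (pow_lt 2 j Rlt_0_2) as H2j.
      assert (Hh : Rabs (exp_half j) = (/ (2 ^ j * INR (fact j)))%R).
      { unfold exp_half, Rdiv. rewrite Rabs_mult, pow_1_abs, Rmult_1_l.
        apply Rabs_pos_eq, Rlt_le, Rinv_0_lt_compat, Rmult_lt_0_compat; lra. }
      assert (HB : (0 < poch B j)%R).
      { apply poch_pos. unfold B, besselT_shift. pose proof (pos_INR N).
        pose proof (Rabs_pos l1). pose proof (Rabs_pos l2). lra. }
      assert (H25 : (0 < (25 / 32) ^ j)%R) by (apply pow_lt; lra).
      rewrite Hh, Rabs_pos_eq
        by (apply Rmult_le_pos; [apply Rlt_le, Rdiv_lt_0_compat|]; lra).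
      apply Rmult_le_reg_r with (INR (fact a) * INR (fact b))%R;
        [apply Rmult_lt_0_compat; lra|].
      rewrite Rmult_assoc.
      eapply Rle_trans;
        [apply Rmult_le_compat_l;
         [apply Rlt_le, Rinv_0_lt_compat, Rmult_lt_0_compat; lra|exact HK]|].
      right. unfold K', bincoef.
      replace (25 / 32)%R with (5 / 4 * (5 / 4) * / 2)%R by field.
      rewrite !Rpow_mult_distr, pow_add, pow_inv. field. lra.
    - apply (ex_series_scal (K := R_AbsRing) (V := R_NormedModule) K'
               (fun j => Rabs (bincoef B j * (25 / 32) ^ j))).
      apply bincoef_disk. rewrite Rabs_pos_eq; lra. }
  exists (fun m a b => proj1_sig (constructive_indefinite_description _ (Hex m a b))).
  intros m a b. apply (proj2_sig (constructive_indefinite_description _ (Hex m a b))).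
Qed.

(** * The image of an element of the Fock space *)

Lemma conv_delta_r (k : nat) (u : nat -> C) :
  conv u (delta k) = conv (delta k) u.
Proof.
  rewrite conv_delta. induction k as [|k IH]; apply functional_extensionality; intros n.
  - unfold conv, delta. destruct n as [|n].
    + rewrite sum_O. simpl. ring.
    + rewrite csum_S, csum_0, Nat.sub_diag.
      * simpl. ring.
      * intros i Hi. rewrite Nat.sub_succ_l by exact Hi. simpl. ring.
  - simpl. rewrite <- IH, <- conv_mulx_r.
    apply conv_ext; [reflexivity|]. intros [|i] _; reflexivity.
Qed.

Lemma has_red_ker (mu : R) (f g : sps) (u1 u2 u3 u4 : nat -> C) :
  in_ker mu (f - g)%S -> has_red mu g u1 u2 u3 u4 -> has_red mu f u1 u2 u3 u4.
Proof.
  intros Hf Hg.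
  replace f with ((f - g) + g)%S by
    (apply sps_ext; intros; unfold sadd, sopp; ring).
  eapply has_red_ext; [exact (has_red_add _ _ _ _ _ _ _ _ _ _ _ Hf Hg)| | | |];
    intros n; unfold zseq; ring.
Qed.

Lemma ker_has_red (mu : R) (f g : sps) (u1 u2 u3 u4 : nat -> C) :
  has_red mu f u1 u2 u3 u4 -> has_red mu g u1 u2 u3 u4 -> in_ker mu (f - g)%S.
Proof.
  intros Hf Hg.
  eapply has_red_ext; [exact (has_red_add _ _ _ _ _ _ _ _ _ _ _ Hf
    (has_red_opp _ _ _ _ _ _ Hg))| | | |]; intros n; unfold zseq; ring.
Qed.

Lemma has_red_sexp (mu s t : R) :
  has_red mu (sexp s t) (expseq s) (fun n => RtoC t * expseq s n) zseq zseq.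
Proof.
  intros n. pose proof (fact_pos n) as Fn. unfold red1, red2, red3, red4, zseq.
  rewrite (mulx_0 (fun i => sexp s t th34 i O)) by reflexivity.
  unfold sexp, expseq. repeat split; simpl fact; by_parts; simpl; field; lra.
Qed.

Lemma has_red_x1_pow (mu : R) (k : nat) : has_red mu (x1 ^ k)%S (delta k) zseq zseq zseq.
Proof.
  rewrite x1_pow. intros [|n]; unfold red1, red2, red3, red4, mono, zseq;
    repeat split; cbn [mulx]; unfold delta at 2; simpl; ring.
Qed.

Lemma has_red_linear (mu : R) (p1 p2 p3 p4 : C) :
  has_red mu (p1 *: x1 + p2 *: x2 + p3 *: x3 + p4 *: x4)%S
    (fun n => p1 * delta 1 n) (fun n => p2 * delta 0 n)
    (fun n => p3 * delta 0 n) (fun n => p4 * delta 0 n).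
Proof.
  rewrite x1_mono, x2_mono, x3_mono, x4_mono.
  intros [|n]; unfold red1, red2, red3, red4, mono, sadd, sscal;
    repeat split; cbn [mulx]; unfold delta; simpl; ring.
Qed.

Lemma conv_scal_l (c : C) (u v : nat -> C) (n : nat) :
  conv (fun i => c * u i) v n = c * conv u v n.
Proof.
  unfold conv. rewrite <- csum_mult_l. apply sum_n_ext; intros. cring.
Qed.

Lemma conv_scal_r (c : C) (u v : nat -> C) (n : nat) :
  conv u (fun i => c * v i) n = c * conv u v n.
Proof.
  unfold conv. rewrite <- csum_mult_l. apply sum_n_ext; intros. cring.
Qed.

Lemma conv_zseq_l (v : nat -> C) : conv zseq v = zseq.
Proof. apply functional_extensionality, conv_0_l. Qed.
Lemma conv_zseq_r (v : nat -> C) : conv v zseq = zseq.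
Proof. apply functional_extensionality, conv_0_r. Qed.
Lemma mulx_zseq : mulx zseq = zseq.
Proof. apply functional_extensionality; now intros [|n]. Qed.

Lemma delta_conv_delta (i k n : nat) : conv (delta i) (delta k) n = delta (i + k) n.
Proof.
  rewrite conv_delta. revert n; induction i as [|i IH]; intros n; [reflexivity|].
  simpl. destruct n as [|n]; [reflexivity|]. simpl. rewrite IH. reflexivity.
Qed.

Lemma has_red_fock (mu : R) (p1 p2 p3 p4 : C) (k : nat) :
  has_red mu ((p1 *: x1 + p2 *: x2 + p3 *: x3 + p4 *: x4) * x1 ^ k)%S
    (fun n => p1 * delta (S k) n) (fun n => p2 * delta k n)
    (fun n => p3 * delta k n) (fun n => p4 * delta k n).
Proof.
  eapply has_red_ext; [exact (has_red_mul _ _ _ _ _ _ _ _ _ _ _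
    (has_red_linear mu p1 p2 p3 p4) (has_red_x1_pow mu k))| | | |];
    intros n; cbv beta; rewrite ?conv_zseq_r, ?mulx_zseq, ?conv_scal_l,
      ?delta_conv_delta; unfold zseq; simpl Nat.add; ring.
Qed.

(** The coefficients of [x^k exp(-x)]. *)
Definition monomial_exp (k : nat) : nat -> C := conv (delta k) (expseq (-1)).

(** The terms with coefficient [0] put all four components in the same
    form of a linear combination of two series. *)
Lemma has_red_exp_fock (mu : R) (p : sps) (p1 p2 p3 p4 : C) (k : nat) :
  in_ker mu
    (p - (p1 *: x1 + p2 *: x2 + p3 *: x3 + p4 *: x4) * x1 ^ k)%S ->
  has_red mu (sexp (-1) (-1) * p)%S
    (fun n => p1 * monomial_exp (S k) n + 0 * monomial_exp (S k) n)
    (fun n => p2 * monomial_exp k n + - p1 * monomial_exp (S k) n)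
    (fun n => p3 * monomial_exp k n + 0 * monomial_exp k n)
    (fun n => p4 * monomial_exp k n + 0 * monomial_exp k n).
Proof.
  intros Hp.
  eapply has_red_ext; [exact (has_red_mul _ _ _ _ _ _ _ _ _ _ _
    (has_red_sexp mu (-1) (-1))
    (has_red_ker _ _ _ _ _ _ _ Hp (has_red_fock mu p1 p2 p3 p4 k)))| | | |];
    intros n; cbv beta; rewrite ?conv_zseq_l, ?mulx_zseq, ?conv_scal_l, ?conv_scal_r,
      ?conv_delta_r; fold (monomial_exp k) (monomial_exp (S k)); unfold zseq;
      by_parts; ring.
Qed.

Lemma cauchy_scal_r (c : C) (u v : nat -> nat -> C) (a b : nat) :
  cauchy u (fun i j => c * v i j) a b = c * cauchy u v a b.
Proof.
  unfold Defs.cauchy. rewrite <- csum_mult_l. apply sum_n_ext; intros.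
  rewrite <- csum_mult_l. apply sum_n_ext; intros. cring.
Qed.

Lemma smul_scal_r (c : C) (f g : sps) : (f * (c *: g))%S = (c *: (f * g))%S.
Proof.
  apply sps_ext; intros [] a b; unfold smul, sscal; rewrite !cauchy_scal_r; ring.
Qed.

Lemma scaled_x1_pow (c : R) (k : nat) :
  ((RtoC c *: x1) ^ k)%S = (RtoC (c ^ k) *: mono th1 k 0)%S.
Proof.
  induction k as [|k IH].
  - simpl. rewrite sconst_1_mono. apply sps_ext; intros; unfold sscal; ring.
  - simpl. rewrite IH, x1_mono, smul_scal_l, smul_scal_r, mono_mul_mono1.
    apply sps_ext; intros; unfold sscal. simpl Nat.add. by_parts; ring.
Qed.

Lemma has_red_Utilde (mu a : R) (k : nat) :
  has_red mu (Utilde a k x1) (Useq a k) zseq zseq zseq.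
Proof.
  assert (H : forall m i j, Utilde a k x1 m i j
            = sum_n (fun l => RtoC (ucoef a k l) *
                (RtoC (4 ^ (k - l)) * mono th1 (k - l) 0 m i j)) k).
  { intros m i j. unfold Utilde, ssum. apply sum_n_ext; intros l.
    rewrite scaled_x1_pow. reflexivity. }
  assert (H0 : forall m i j, (m <> th1 \/ j <> O) -> Utilde a k x1 m i j = 0).
  { intros m i j Hm. rewrite H. apply csum_0. intros l _.
    destruct Hm as [Hm|Hj].
    - destruct m; [easy| | |]; unfold mono; ring.
    - destruct j; [easy|]. destruct m; unfold mono, delta; simpl; ring. }
  intros n. unfold red1, red2, red3, red4, zseq.
  rewrite (H0 th1 n 1%nat), (H0 th3 n O), (H0 th4 n O)
    by (first [left; discriminate | right; discriminate]).
  repeat split.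
  - rewrite H. unfold Useq. destruct (Nat.leb_spec n k) as [Hn|Hn].
    + transitivity (sum_n (fun l => delta (k - n) l
                     * RtoC (ucoef a k l * 4 ^ (k - l))) k).
      * apply sum_n_ext_loc; intros l Hl. unfold mono, delta.
        destruct (Nat.eqb_spec n (k - l)); destruct (Nat.eqb_spec l (k - n)); try lia;
          simpl; by_parts; ring.
      * rewrite csum_delta, (proj2 (Nat.leb_le _ _)) by lia.
        replace (k - (k - n))%nat with n by lia. reflexivity.
    + apply csum_0. intros l Hl. unfold mono, delta.
      destruct (Nat.eqb_spec n (k - l)); [lia|]. simpl. ring.
  - rewrite mulx_0; [ring|]. intros i. apply H0. left; discriminate.
Qed.

Lemma Vtilde_Utilde (a : R) (k : nat) (x : sps) : Vtilde a k x = Utilde (a - 1) k x.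
Proof.
  apply sps_ext; intros. unfold Vtilde, hypU, Utilde, ssum.
  apply sum_n_ext; intros i. unfold sscal. f_equal. f_equal.
  replace (1 - INR k - (1 - a))%R with (a - 1 - INR k + 1)%R by ring. ring.
Qed.

(** The right-hand side for [lambda = alpha], with [a] for [alpha]. *)
Definition image_series (a : R) (k : nat) (p1 p2 p3 p4 : C) : sps :=
  (RtoC (1 / Rpower 2 (1 + a)) * p1 *: (Utilde a k x1 * sexp (-2) (-2))
   + RtoC (1 / Rpower 2 (1 + a)) * p2 *: (Utilde a (k - 1) x1 * sexp (-2) 2)
   + RtoC (1 / Rpower 2 (a - 1)) *:
       ((p3 *: x3 + p4 *: x4) * Vtilde a (k - 1) x1 * sexp (-2) 0))%S.

Definition image_seq (a : R) (k : nat) : nat -> C := fun n =>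
  RtoC (Rpower 2 (- a)) * conv (Useq a k) (expseq (-2)) n.

Lemma has_red_odd_linear (mu : R) (p3 p4 : C) :
  has_red mu (p3 *: x3 + p4 *: x4)%S zseq zseq
    (fun n => p3 * delta 0 n) (fun n => p4 * delta 0 n).
Proof.
  rewrite x3_mono, x4_mono.
  intros [|n]; unfold red1, red2, red3, red4, mono, sadd, sscal, zseq;
    repeat split; cbn [mulx]; unfold delta; simpl; ring.
Qed.

Lemma has_red_Utilde_sexp (mu a s t : R) (k : nat) :
  has_red mu (Utilde a k x1 * sexp s t)%S (conv (Useq a k) (expseq s))
    (fun n => RtoC t * conv (Useq a k) (expseq s) n) zseq zseq.
Proof.
  eapply has_red_ext; [exact (has_red_mul _ _ _ _ _ _ _ _ _ _ _
    (has_red_Utilde mu a k) (has_red_sexp mu s t))| | | |];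
    intros n; cbv beta; rewrite ?conv_zseq_l, ?conv_zseq_r, ?mulx_zseq, ?conv_scal_r;
      unfold zseq; ring.
Qed.

Lemma has_red_odd_Utilde_sexp (mu a s : R) (k : nat) (p3 p4 : C) :
  has_red mu ((p3 *: x3 + p4 *: x4) * Utilde a k x1 * sexp s 0)%S zseq zseq
    (fun n => p3 * conv (Useq a k) (expseq s) n)
    (fun n => p4 * conv (Useq a k) (expseq s) n).
Proof.
  assert (H : has_red mu ((p3 *: x3 + p4 *: x4) * Utilde a k x1)%S zseq zseq
            (fun n => p3 * Useq a k n) (fun n => p4 * Useq a k n)).
  { eapply has_red_ext; [exact (has_red_mul _ _ _ _ _ _ _ _ _ _ _
      (has_red_odd_linear mu p3 p4) (has_red_Utilde mu a k))| | | |];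
      intros n; cbv beta; rewrite ?conv_zseq_l, ?conv_zseq_r, ?mulx_zseq, ?conv_scal_l,
        ?conv_delta; unfold zseq; simpl; ring. }
  eapply has_red_ext; [exact (has_red_mul _ _ _ _ _ _ _ _ _ _ _
    H (has_red_sexp mu s 0))| | | |];
    intros n; cbv beta; rewrite ?conv_zseq_l, ?conv_zseq_r, ?mulx_zseq, ?conv_scal_l;
      unfold zseq; ring.
Qed.

Lemma has_red_image_series (mu a : R) (k : nat) (p1 p2 p3 p4 : C) :
  has_red mu (image_series a (S k) p1 p2 p3 p4)
    (fun n => RtoC (1 / 2) * (p1 * image_seq a (S k) n + p2 * image_seq a k n))
    (fun n => p2 * image_seq a k n - p1 * image_seq a (S k) n)
    (fun n => p3 * image_seq (a - 1) k n) (fun n => p4 * image_seq (a - 1) k n).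
Proof.
  assert (H1 : (1 / Rpower 2 (1 + a) = 1 / 2 * Rpower 2 (- a))%R).
  { rewrite Rpower_plus, Rpower_1, Rpower_Ropp by lra.
    assert (0 < Rpower 2 a)%R by apply exp_pos. field. lra. }
  assert (H2 : (1 / Rpower 2 (a - 1) = Rpower 2 (- (a - 1)))%R).
  { rewrite Rpower_Ropp. field. apply Rgt_not_eq, exp_pos. }
  unfold image_series. replace (S k - 1)%nat with k by lia.
  rewrite H1, H2, Vtilde_Utilde. clear H1 H2.
  eapply has_red_ext; [apply has_red_add; [apply has_red_add|]; apply has_red_scal;
    [apply has_red_Utilde_sexp|apply has_red_Utilde_sexp|apply has_red_odd_Utilde_sexp]
    | | | |]; intros n; cbv beta; unfold image_seq, zseq; by_parts; field.
Qed.

(** Both cases of the theorem in one: [a = alpha], [mu = 1], or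
    [a = 1 / alpha], [mu = alpha] after exchanging [x1] and [x2]. *)
Lemma exp_besselT_fock (a mu : R) (p : sps) (p1 p2 p3 p4 : C) (k : nat) :
  (1 <= k)%nat -> is_poly p ->
  in_ker mu (p - (p1 *: x1 + p2 *: x2 + p3 *: x3 + p4 *: x4) * x1 ^ (k - 1))%S ->
  exists F, is_exp_besselT a 1 mu (a * mu) (sexp (-1) (-1) * p)%S F
            /\ in_ker mu (F - image_series a k p1 p2 p3 p4)%S.
Proof.
  intros Hk Hp Hker. destruct k as [|k]; [lia|].
  replace (S k - 1)%nat with k in Hker by lia.
  destruct (exp_besselT_ex a 1 mu (a * mu) p Hp) as [F HF].
  exists F. split; [exact HF|].
  eapply ker_has_red; [|apply has_red_image_series].
  eapply has_red_ext; [exact (has_red_exp_besselT a mu _ F _ _ _ _ _ _ _ _ HF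
    (has_red_exp_fock mu p p1 p2 p3 p4 k Hker)
    (is_exp_besselD_lin _ _ _ _ _ _ _ (is_exp_besselD_monomial a (S k))
       (is_exp_besselD_monomial a (S k)))
    (is_exp_besselD_lin _ _ _ _ _ _ _ (is_exp_besselD_monomial a k)
       (is_exp_besselD_monomial a (S k)))
    (is_exp_besselD_lin _ _ _ _ _ _ _ (is_exp_besselD_monomial (a - 1) k)
       (is_exp_besselD_monomial (a - 1) k))
    (is_exp_besselD_lin _ _ _ _ _ _ _ (is_exp_besselD_monomial (a - 1) k)
       (is_exp_besselD_monomial (a - 1) k)))| | | |];
    intros n; cbv beta;
    fold (image_seq a k n) (image_seq a (S k) n) (image_seq (a - 1) k n);
    by_parts; field.
Qed.

(** * Exchanging the even variables *)

Definition swap12 (f : sps) : sps := fun m a b => f m b a.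

Lemma swap12_mul (f g : sps) : swap12 (f * g)%S = (swap12 f * swap12 g)%S.
Proof.
  assert (H : forall u v a b, cauchy u v a b
            = cauchy (fun i j => u j i) (fun i j => v j i) b a).
  { intros u v a b. unfold Defs.cauchy. apply sum_n_switch. }
  apply sps_ext; intros [] a b; unfold swap12, smul;
    rewrite ?(H _ _ b a); reflexivity.
Qed.

Lemma swap12_mono (m : oddmon) (k l : nat) : swap12 (mono m k l) = mono m l k.
Proof.
  apply sps_ext; intros m' a b; unfold swap12, mono.
  destruct m, m'; try reflexivity; ring.
Qed.

Lemma swap12_x1 : swap12 x1 = x2. Proof. now rewrite x1_mono, x2_mono, swap12_mono. Qed.
Lemma swap12_x2 : swap12 x2 = x1. Proof. now rewrite x1_mono, x2_mono, swap12_mono. Qed.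
Lemma swap12_x3 : swap12 x3 = x3. Proof. now rewrite x3_mono, swap12_mono. Qed.
Lemma swap12_x4 : swap12 x4 = x4. Proof. now rewrite x4_mono, swap12_mono. Qed.

Lemma swap12_add (f g : sps) : swap12 (f + g)%S = (swap12 f + swap12 g)%S.
Proof. reflexivity. Qed.
Lemma swap12_opp (f : sps) : swap12 (- f)%S = (- swap12 f)%S.
Proof. reflexivity. Qed.
Lemma swap12_scal (c : C) (f : sps) : swap12 (c *: f)%S = (c *: swap12 f)%S.
Proof. reflexivity. Qed.

Lemma swap12_sconst_0 : sconst 0 = swap12 (sconst 0).
Proof. apply sps_ext; intros [] [|a] [|b]; reflexivity. Qed.

Lemma x2_mul_x1 : (x2 * x1 = x1 * x2)%S.
Proof. now rewrite x1_mono, x2_mono, !mono_mul_mono1. Qed.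

Lemma swap12_pow (f : sps) (n : nat) : swap12 (f ^ n)%S = (swap12 f ^ n)%S.
Proof.
  induction n as [|n IH]; simpl.
  - now rewrite sconst_1_mono, swap12_mono.
  - now rewrite swap12_mul, IH.
Qed.

Lemma swap12_sexp (s t : R) : swap12 (sexp s t) = sexp t s.
Proof.
  apply sps_ext; intros [] a b; unfold swap12, sexp; try reflexivity.
  f_equal. ring.
Qed.

Lemma swap12_Utilde (a : R) (k : nat) (x : sps) :
  swap12 (Utilde a k x) = Utilde a k (swap12 x).
Proof.
  apply sps_ext; intros. unfold Utilde, ssum.
  change (swap12 ?f m a0 b) with (f m b a0). apply sum_n_ext; intros i.
  rewrite <- swap12_scal, <- swap12_pow. reflexivity.
Qed.

(** The exchange of the even variables permutes the parameters. *)
Lemma swap12_iter_besselT (l1 l2 m1 m2 : R) (f : sps) (j : nat) :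
  Nat.iter j (besselT l1 l2 m1 m2) (swap12 f)
  = swap12 (Nat.iter j (besselT l2 l1 m2 m1) f).
Proof.
  induction j as [|j IH]; [reflexivity|]. simpl. rewrite IH.
  apply sps_ext; intros [] a b; unfold besselT, swap12; ring.
Qed.

(** * From the ideals to the reduction and back *)

Definition ideal_closed (K : sps -> Prop) : Prop :=
  K (sconst 0) /\ (forall f g, K f -> K g -> K (f + g)%S)
  /\ (forall h f, K f -> K (h * f)%S) /\ (forall h f, K f -> K (f * h)%S).

(** Proves a property of all members of a generated ideal; applied to the
    kernel of the reduction and to its image under the exchange of
    [x1] and [x2]. *)
Lemma ideal_gen_least (A G K : sps -> Prop) (f : sps) : ideal_closed K ->
  (forall g, G g -> K g) -> ideal_gen A G f -> K f.
Proof. intros (H0 & Hadd & Hl & Hr) HG. induction 1; auto. Qed.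

Lemma ideal_closed_ker (mu : R) : ideal_closed (in_ker mu).
Proof.
  split; [apply in_ker_0|]. split; [intros; now apply in_ker_add|].
  split; intros; [now apply in_ker_mul_l | now apply in_ker_mul_r].
Qed.

Lemma in_ker_gens (mu : R) (g : sps) :
  (g = RtoC (2 * mu) *: (x1 * x2) + x3 * x4 \/ g = x2 ^ 2 \/ g = x2 * x3
    \/ g = x2 * x4)%S -> in_ker mu g.
Proof.
  rewrite x3_mul_x4, x2_sqr, x1_mono, x2_mono, x3_mono, x4_mono, !mono_mul_mono1.
  intros [->|[->|[->| ->]]] n; unfold red1, red2, red3, red4, zseq, sadd, sscal, mono;
    simpl Nat.add; (split; [|split; [|split]]);
    destruct n as [|[|n]]; cbn [mulx]; unfold delta; simpl Nat.eqb;
    cbv iota; by_parts; ring.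
Qed.

(** For [alpha <> 1] only one of the two lists of generators applies. *)
Lemma eq_fock_ker (alpha : R) (f g : sps) : alpha <> 1%R ->
  eq_fock alpha alpha f g -> in_ker 1 (f - g)%S.
Proof.
  intros Ha. apply ideal_gen_least; [apply ideal_closed_ker|].
  intros h [[_ Hh]|[H1 _]]; [|now destruct Ha].
  apply in_ker_gens. rewrite Rmult_1_r. exact Hh.
Qed.

Lemma eq_fock_ker_swap12 (alpha : R) (f g : sps) : alpha <> 1%R ->
  eq_fock alpha 1 f g -> in_ker alpha (swap12 f - swap12 g)%S.
Proof.
  intros Ha. rewrite <- swap12_opp, <- swap12_add.
  apply (ideal_gen_least _ _ (fun f => in_ker alpha (swap12 f))).
  - destruct (ideal_closed_ker alpha) as (H0 & Hadd & Hl & Hr).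
    split; [|split; [|split]].
    + rewrite <- (swap12_sconst_0) . exact H0.
    + intros; rewrite swap12_add; auto.
    + intros; rewrite swap12_mul; auto.
    + intros; rewrite swap12_mul; auto.
  - intros h [[H1 _]|[_ Hh]]; [now destruct Ha|].
    apply in_ker_gens.
    destruct Hh as [->|[->|[->| ->]]];
      rewrite ?swap12_add, ?swap12_scal, ?swap12_pow, ?swap12_mul,
        ?swap12_x1, ?swap12_x2, ?swap12_x3, ?swap12_x4;
      rewrite ?x2_mul_x1; auto 6.
Qed.

Lemma ker_eq_series (alpha : R) (f g : sps) :
  in_ker 1 (f - g)%S -> eq_series alpha alpha f g.
Proof.
  intros H. destruct (in_ker_decomp _ _ H) as (u & v & w & z & E).
  unfold eq_series. rewrite E, Rmult_1_r.
  repeat apply ideal_add; apply ideal_mul_r; try exact I;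
    apply ideal_in, ideal_in; left; auto.
Qed.

Lemma ker_swap12_eq_series (alpha : R) (f g : sps) :
  in_ker alpha (swap12 f - swap12 g)%S -> eq_series alpha 1 f g.
Proof.
  intros H. destruct (in_ker_decomp _ _ H) as (u & v & w & z & E).
  unfold eq_series. change (f - g)%S with (swap12 (swap12 f - swap12 g)%S).
  rewrite E, !swap12_add, !swap12_mul, swap12_add, swap12_scal, swap12_pow, !swap12_mul.
  rewrite swap12_x1, swap12_x2, swap12_x3, swap12_x4, x2_mul_x1.
  repeat apply ideal_add; apply ideal_mul_r; try exact I;
    apply ideal_in, ideal_in; right; auto.
Qed.

Lemma is_piCinv_besselT (alpha lam : R) (p F : sps) :
  is_exp_besselT lam (lam / alpha) 1 alpha (sexp (-1) (-1) * p)%S F ->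
  is_piCinv alpha lam p F.
Proof.
  intros H m a b. unfold piCinv_term.
  replace (fun g => (bessel1 alpha lam g + bessel2 alpha lam g)%S)
    with (besselT lam (lam / alpha) 1 alpha)
    by (apply functional_extensionality; intros g; symmetry; apply bessel_besselT).
  exact (H m a b).
Qed.

Theorem theorem7p3 :
  forall (alpha lam : R), alpha <> 0%R -> alpha <> 1%R ->
    (lam = 1%R \/ lam = alpha) ->
  forall (p1 p2 p3 p4 : C) (k : nat), (1 <= k)%nat ->
    (lam = alpha ->
     forall p : sps, is_poly p ->
       eq_fock alpha lam p
         ((p1 *: x1 + p2 *: x2 + p3 *: x3 + p4 *: x4) * x1 ^ (k - 1))%S ->
     exists F : sps,
       is_piCinv alpha lam p F /\
       eq_series alpha lam F
         (RtoC (1 / Rpower 2 (1 + alpha)) * p1 *: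
            (Utilde alpha k x1 * sexp (-2) (-2))
          + RtoC (1 / Rpower 2 (1 + alpha)) * p2 *:
            (Utilde alpha (k - 1) x1 * sexp (-2) 2)
          + RtoC (1 / Rpower 2 (alpha - 1)) *:
            ((p3 *: x3 + p4 *: x4) * Vtilde alpha (k - 1) x1 * sexp (-2) 0))%S)
    /\
    (lam = 1%R ->
     forall p : sps, is_poly p ->
       eq_fock alpha lam p
         ((p1 *: x1 + p2 *: x2 + p3 *: x3 + p4 *: x4) * x2 ^ (k - 1))%S ->
     exists F : sps,
       is_piCinv alpha lam p F /\
       eq_series alpha lam F
         (RtoC (1 / Rpower 2 (1 + / alpha)) * p2 *:
            (Utilde (/ alpha) k x2 * sexp (-2) (-2))
          + RtoC (1 / Rpower 2 (1 + / alpha)) * p1 *: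
            (Utilde (/ alpha) (k - 1) x2 * sexp 2 (-2))
          + RtoC (1 / Rpower 2 (/ alpha - 1)) *:
            ((p3 *: x3 + p4 *: x4) * Vtilde (/ alpha) (k - 1) x2
             * sexp 0 (-2)))%S).
Proof.
  intros alpha lam Ha0 Ha1 _ p1 p2 p3 p4 k Hk. split; intros Hlam p Hp Hq; subst lam.
  - destruct (exp_besselT_fock alpha 1 p p1 p2 p3 p4 k Hk Hp (eq_fock_ker _ _ _ Ha1 Hq))
      as [F [HF HR]].
    exists F. split; [|apply ker_eq_series, HR].
    apply is_piCinv_besselT. rewrite Rmult_1_r in HF.
    replace (alpha / alpha)%R with 1%R by (field; exact Ha0). exact HF.
  - apply eq_fock_ker_swap12 in Hq; [|exact Ha1].
    rewrite swap12_mul, swap12_pow, !swap12_add, !swap12_scal,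
      swap12_x1, swap12_x2, swap12_x3, swap12_x4 in Hq.
    replace (p1 *: x2 + p2 *: x1)%S with (p2 *: x1 + p1 *: x2)%S in Hq
      by (apply sps_ext; intros; unfold sadd; ring).
    assert (Hp' : is_poly (swap12 p)).
    { destruct Hp as [N HN]. exists N. intros m a b Hab. apply HN. lia. }
    destruct (exp_besselT_fock (/ alpha) alpha (swap12 p) p2 p1 p3 p4 k Hk Hp' Hq)
      as [F [HF HR]].
    exists (swap12 F). split.
    + apply is_piCinv_besselT. intros m a b. specialize (HF m b a).
      rewrite Rinv_l in HF by exact Ha0.
      eapply is_Cseries_ext; [exact HF| |reflexivity].
      intros j. cbv beta. f_equal. unfold Rdiv. rewrite Rmult_1_l.
      replace (sexp (-1) (-1) * swap12 p)%S with (swap12 (sexp (-1) (-1) * p)%S)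
        by (now rewrite swap12_mul, swap12_sexp).
      rewrite swap12_iter_besselT. reflexivity.
    + apply ker_swap12_eq_series. change (swap12 (swap12 F)) with F.
      rewrite !Vtilde_Utilde, !swap12_add, !swap12_scal, !swap12_mul,
        !swap12_Utilde, !swap12_add, !swap12_scal,
        !swap12_sexp, swap12_x2, swap12_x3, swap12_x4, <- Vtilde_Utilde.
      exact HR.
Qed.
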